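(* For $\mu,\nu\in\mathcal{S}\mathrm{Curr}(F_N)$ the series \[ \widehat c(\mu,\nu):=\sum_{[T]\in\overline{\mathrm{Sub}}(X,1)/F_N}(\mu\times\nu)(\mathcal{R}(T))\] converges (with value at most $V(\mu)V(\nu)$), and the resulting $\mathbb{R}_{\geq0}$-bilinear map $\widehat c\colon\mathcal{S}\mathrm{Curr}(F_N)\times\mathcal{S}\mathrm{Curr}(F_N)\to\mathbb{R}_{\geq0}$ is continuous.
   Context: $N\geq2$, $F_N$ free with free basis $A$, $X$ its Cayley graph (a tree with vertex set $F_N$, unit edge lengths, metric $d_X$), $\partial X$ its boundary. $\mathcal{C}_N$: closed subsets of $\partial X$ with at least two points, with the Vietoris (Hausdorff) topology; $\mathcal{S}\mathrm{Curr}(F_N)$: $F_N$-invariant Borel measures on $\mathcal{C}_N$ finite on compact sets, with the weak-* topology. For $S\in\mathcal{C}_N$, $\mathrm{Conv}(S)\subset X$ is the union of all bi-infinite geodesics joining two points of $S$. $\mathrm{Sub}(X,1)$: finite subtrees of $X$ with at least two vertices containing $1$; $\overline{\mathrm{Sub}}(X,1)=\mathrm{Sub}(X,1)\cup\{\{1\}\}$. $\overline{\mathrm{Sub}}(X,1)/F_N$ is the set of classes under $T\sim T'$ iff $gT=T'$ for some $g\in F_N$. For $T\in\overline{\mathrm{Sub}}(X,1)$, $\mathcal{R}(T)=\{(S_1,S_2)\in\mathcal{C}_N\times\mathcal{C}_N:\mathrm{Conv}(S_1)\cap\mathrm{Conv}(S_2)=T\}$; $(\mu\times\nu)(\mathcal{R}(T))$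 depends only on $[T]$. Subset cylinders: for an oriented edge $e$, $\mathrm{Cyl}(e)$ is the set of ends of rays starting with $e$; for a finite subtree $T$ with $\ge2$ vertices and terminal edges $e_1,\dots,e_m$, $\mathrm{SCyl}(T)=\{S: S\subset\bigcup\mathrm{Cyl}(e_i), S\cap\mathrm{Cyl}(e_i)\ne\emptyset\ \forall i\}$. $\mathcal{R}_1$: finite subtrees containing $1$, with $1$ of degree $\ge2$ and all degree-one vertices at distance $1$ from $1$. $V(\mu)=\sum_{T\in\mathcal{R}_1}\mu(\mathrm{SCyl}(T))$. *)

(* Defs.v *)
From HB Require Import structures.
From mathcomp Require Import all_boot all_order all_algebra.
From mathcomp Require Import all_classical all_reals all_analysis.

Set Implicit Arguments.
Unset Strict Implicit.
Unset Printing Implicit Defensive.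

Import Order.TTheory GRing.Theory Num.Theory.
Import numFieldNormedType.Exports.
Local Open Scope classical_set_scope.

(* Free group F_N of rank N = n.+2 (this encodes the standing hypothesis     *)
(* N >= 2), its Cayley tree X, the boundary dX, the space C_N of closed      *)
(* subsets of dX with at least two points (with the Vietoris = Hausdorff     *)
(* topology), subset currents, and the quantities of the statement.          *)

Section FreeGroup.
Variable n : nat.

(* letters a^{+1}, a^{-1} for a in the free basis A = 'I_(n.+2);             *)
(* (i, false) is the basis element a_i, (i, true) is its inverse.            *)
Definition letter := ('I_n.+2 * bool)%type.
Definition linv (x : letter) : letter := (x.1, ~~ x.2).

(* Elements of F_N = vertices of X = reduced words. *)
Definition word := seq letter.
Definition reduced (w : word) : bool := sorted (fun x y => y != linv x) w.

Definition push (x : letter) (w : word) : word :=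
  if w is y :: w' then (if y == linv x then w' else x :: w) else [:: x].
Definition mul (u v : word) : word := foldr push v u.
Definition winv (u : word) : word := rev (map linv u).

Definition dX (u v : word) : nat := size (mul (winv u) v).
Definition adjacent (u v : word) : Prop := exists a : letter, v = mul u [:: a].

(* Boundary dX: ends of geodesic rays from 1 = infinite reduced words. *)
Definition bseq := nat -> letter.
Definition reduced_ray (xi : bseq) : Prop := forall k, xi k.+1 != linv (xi k).
Definition pref (xi : bseq) (k : nat) : word := mkseq xi k.

Definition bpush (x : letter) (xi : bseq) : bseq :=
  if xi 0%N == linv x then (fun k => xi k.+1)
  else (fun k => if k is m.+1 then xi m else x).
Definition bact (g : word) (xi : bseq) : bseq := foldr bpush xi g.

(* closed subsets of dX (for the topology generated by cylinders) *)
Definition closed_bd (S : set bseq) : Prop :=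
  S `<=` reduced_ray /\
  forall xi, reduced_ray xi ->
    (forall k, exists eta, S eta /\ pref eta k = pref xi k) -> S xi.

Record CN := mkCN {
  cset : set bseq;
  cset_closed : closed_bd cset;
  cset_two : exists xi eta, cset xi /\ cset eta /\ xi <> eta }.

HB.instance Definition _ := gen_eqMixin CN.
HB.instance Definition _ := gen_choiceMixin CN.

Definition const_ray (i : 'I_n.+2) : bseq := fun _ => (i, false).

Lemma full_closed : closed_bd reduced_ray.
Proof. by split. Qed.

Lemma full_two : exists xi eta, reduced_ray xi /\ reduced_ray eta /\ xi <> eta.
Proof.
exists (const_ray ord0), (const_ray (Ordinal (isT : 1 < n.+2))).
split; first by move=> k.
split; first by move=> k.
by move=> /(congr1 (fun f => val (f 0%N).1)).
Qed.

Definition CN_point : CN := mkCN full_closed full_two.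
HB.instance Definition _ := isPointed.Build CN CN_point.

(* Vietoris (= Hausdorff metric) topology on C_N: since dX is a compact     *)
(* ultrametric space (visual metric 2^-(length of common prefix)), the      *)
(* Hausdorff balls are exactly the sets of S' with the same length-k        *)
(* prefixes as S.                                                            *)
Definition levelset (k : nat) (S : CN) : set word := [set pref xi k | xi in cset S].

Definition CN_open (U : set CN) : Prop :=
  forall S, U S -> exists k, forall S', levelset k S' = levelset k S -> U S'.

Lemma take_mkseq' (T : Type) (f : nat -> T) k m :
  (k <= m)%N -> take k (mkseq f m) = mkseq f k.
Proof. by move=> km; rewrite /mkseq -map_take take_iota (minn_idPl km). Qed.

Lemma levelset_le k m S S' : (k <= m)%N ->
  levelset m S' = levelset m S -> levelset k S' = levelset k S.
Proof.
move=> km E.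
have P : forall T, levelset k T = [set take k w | w in levelset m T].
  move=> T; apply/seteqP; split.
    move=> w [xi Txi <-]; exists (pref xi m); first by exists xi.
    by rewrite /pref take_mkseq'.
  by move=> w [_ [xi Txi <-] <-]; exists xi => //; rewrite /pref take_mkseq'.
by rewrite P E -P.
Qed.

Lemma CN_openT : CN_open setT.
Proof. by move=> S _; exists 0%N. Qed.

Lemma CN_openI : setI_closed CN_open.
Proof.
move=> U V oU oV S [US VS].
have [k1 H1] := oU S US; have [k2 H2] := oV S VS.
exists (maxn k1 k2) => S' E; split.
  by apply: H1; apply: levelset_le E; exact: leq_maxl.
by apply: H2; apply: levelset_le E; exact: leq_maxr.
Qed.

Lemma CN_open_bigU (I : Type) (f : I -> set CN) :
  (forall i, CN_open (f i)) -> CN_open (\bigcup_i f i).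
Proof.
move=> hf S [i _ fiS]; have [k H] := hf i S fiS.
by exists k => S' E; exists i => //; exact: H.
Qed.

HB.instance Definition _ :=
  isOpenTopological.Build CN CN_openT CN_openI CN_open_bigU.

HB.instance Definition _ := @isMeasurable.Build default_measure_display CN
  <<s (@open CN) >> (@sigma_algebra0 _ setT (@open CN))
  (@sigma_algebraC CN (@open CN))
  (@sigma_algebra_bigcup _ setT (@open CN)).

Definition act_preimage (g : word) (A : set CN) : set CN :=
  [set S | exists2 S', A S' & cset S' = bact g @` cset S].

(* finite subtrees of X (vertex sets of finite connected subgraphs) *)
Definition is_subtree (T : set word) : Prop :=
  finite_set T /\ T `<=` reduced /\ T !=set0 /\
  forall u v, T u -> T v -> exists p : seq word,
    [/\ path (fun a b => `[< adjacent a b >]) u p, last u p = v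
      & all (fun w => `[< T w >]) p].

Definition Sub1 (T : set word) : Prop :=
  is_subtree T /\ T [::] /\ exists u v, [/\ T u, T v & u <> v].
Definition Subbar1 (T : set word) : Prop := Sub1 T \/ T = [set [::]].

Definition deg_one (T : set word) (v : word) : Prop :=
  T v /\ exists a, T (mul v [:: a]) /\ forall b, T (mul v [:: b]) -> b = a.

(* the oriented terminal edge  w -> w a  of T (pointing to the leaf w a) *)
Definition terminal_edge (T : set word) (w : word) (a : letter) : Prop :=
  T w /\ deg_one T (mul w [:: a]).

(* Cyl(e) for the oriented edge e = (w, w a): ends of rays starting with e *)
Definition Cyl (w : word) (a : letter) : set bseq :=
  [set xi | bact (winv w) xi 0%N = a].

Definition SCyl (T : set word) : set CN :=
  [set S | (forall xi, cset S xi ->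
              exists w a, terminal_edge T w a /\ Cyl w a xi) /\
           (forall w a, terminal_edge T w a ->
              exists xi, cset S xi /\ Cyl w a xi)].

Definition R1 (T : set word) : Prop :=
  [/\ is_subtree T, T [::],
      (exists a b : letter, [/\ a <> b, T [:: a] & T [:: b]])
    & forall v, deg_one T v -> size v = 1%N].

Definition geodesic_line (g : int -> word) : Prop :=
  (forall i, reduced (g i)) /\ forall i j, dX (g i) (g j) = absz (i - j)%R.
Definition converges_to (g : nat -> word) (xi : bseq) : Prop :=
  forall k, exists m, forall i, (m <= i)%N -> prefix (pref xi k) (g i).

Definition Conv (S : set bseq) : set word :=
  [set v | exists xi eta, [/\ S xi, S eta, xi <> eta &
     exists g : int -> word, [/\ geodesic_line g,
        converges_to (fun k : nat => g (Posz k)) xi,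
        converges_to (fun k : nat => g (- Posz k)%R) eta &
        exists i, g i = v]]].

Definition RR (T : set word) : set (CN * CN) :=
  [set p | Conv (cset p.1) `&` Conv (cset p.2) = T].

Definition tact (g : word) (T : set word) : set word := [set mul g v | v in T].
Definition tclass (T : set word) : set (set word) :=
  [set T' | Subbar1 T' /\ exists2 g, reduced g & T' = tact g T].
Definition tclasses : set (set (set word)) :=
  [set C | exists2 T, Subbar1 T & C = tclass T].
Definition rep (C : set (set word)) : set word := xget set0 C.

End FreeGroup.

Section Currents.
Context {R : realType} {n : nat}.
Local Open Scope ring_scope.
Local Open Scope ereal_scope.

Definition SCurr (mu : {measure set (CN n) -> \bar R}) : Prop :=
  (forall (g : word n) (A : set (CN n)), reduced g -> measurable A ->
     mu (act_preimage g A) = mu A) /\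
  (forall K : set (CN n), compact K -> mu K < +oo).

Definition Vol (mu : {measure set (CN n) -> \bar R}) : \bar R :=
  \esum_(T in @R1 n) mu (SCyl T).

Definition chat (mu nu : {measure set (CN n) -> \bar R}) : \bar R :=
  \esum_(C in @tclasses n) (mu \x nu) (RR (rep C)).

Definition Cc (f : CN n -> R) : Prop :=
  continuous f /\
  exists K : set (CN n), compact K /\ forall S, ~ K S -> f S = 0%R.

End Currents.

(* Main.v *)
Require Import Defs.
From mathcomp Require Import finmap.
From HB Require Import structures.
From mathcomp Require Import all_boot all_order all_algebra.
From mathcomp Require Import all_classical all_reals all_analysis.
From mathcomp Require Import measurable_realfun zify ring lra.
Import Order.TTheory GRing.Theory Num.Theory.
Import numFieldNormedType.Exports.
Import Defs.

(** Every class of trees has a representative [T] through the identity, and then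
    [RR T] lies in [K1 * K1], where [K1] is the compact open set of all [S] whose
    hull contains the identity.  Since the sets [RR T] are pairwise disjoint, the
    series is at most [mu K1 * nu K1], and [mu K1 <= V(mu)].

    The intersection of two hulls is convex, so that for finite [T] membership
    in [RR T] is decided by the prefixes of a fixed length of the ends in [S1]
    and [S2]: [RR T] is a finite union of products of compact open sets, and its
    measure is a polynomial in the masses of finitely many of them.  This gives
    bilinearity, and the continuity of every finite part of the series.

    The tail is uniformly small.  If [T] contains a vertex [v] at distance more
    than [L] from the identity, then it contains the [L + 1] first vertices
    [v_0, ..., v_L] of the geodesic to [v], and the translates [v_i^-1 T] are
    pairwise distinct because a torsion-free group acts freely on finite
    subtrees.  All of them contain the identity and have the same measure as
    [T], hence [(L + 1)] times the tail is still at most [mu K1 * nu K1]. *)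

Set Implicit Arguments.
Unset Strict Implicit.
Unset Printing Implicit Defensive.
Local Open Scope classical_set_scope.

(** * The free group and its boundary *)

Arguments reduced : simpl never.

Section FreeGroup.
Variable n : nat.
Implicit Types (x y a b : letter n) (u v w g : word n) (xi eta : bseq n).

Lemma linvK : involutive (@linv n).
Proof. by case=> i b; rewrite /linv /= negbK. Qed.

Lemma linv_neq x : linv x != x.
Proof. by case: x => i [|]; rewrite /linv /= xpair_eqE andbF. Qed.

Lemma reduced_cons x w : reduced (x :: w) =
  (if w is y :: _ then y != linv x else true) && reduced w.
Proof. by case: w. Qed.

Lemma reduced_cat u v : reduced (u ++ v) -> reduced u /\ reduced v.
Proof.
elim: u => [|x u IH] //; rewrite cat_cons !reduced_cons => /andP[h /IH[-> ->]].
by split=> //; rewrite andbT; case: u h {IH}.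
Qed.

Lemma cat_reduced u v a : reduced u -> reduced v ->
  (if v is y :: _ then y != linv (last a u) else true) ->
  reduced (u ++ v).
Proof.
case: u => [|x u] //= ru; rewrite /reduced /= cat_path.
move: ru; rewrite /reduced /= => -> /=.
by case: v => //= y v -> ->.
Qed.

Lemma push_reduced x w : reduced w -> reduced (push x w).
Proof.
case: w => [|y w] //= rw; case: ifP => [_|yx].
  by case: w rw => // z w; rewrite /reduced /= => /andP[].
by rewrite reduced_cons yx.
Qed.

Lemma mul_reduced u v : reduced v -> reduced (mul u v).
Proof. by move=> rv; elim: u => //= x u; exact: push_reduced. Qed.

Lemma pushK x w : reduced w -> push (linv x) (push x w) = w.
Proof.
case: w => [|y w] /=; first by rewrite linvK eqxx.
move=> rw; case: ifP => [/eqP e|yx] /=; last by rewrite linvK eqxx.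
move: rw; rewrite e reduced_cons => /andP[].
by case: w => //= z w /negbTE ->.
Qed.

Lemma mul_cat u v w : mul (u ++ v) w = mul u (mul v w).
Proof. exact: foldr_cat. Qed.

(** The inductive step of associativity: when [x] cancels the head of [v], it meets its inverse in
    the product as well, and the two pushes undo each other. *)
Lemma mul_push x v w : reduced w -> mul (push x v) w = push x (mul v w).
Proof.
move=> rw; case: v => //= z v; case: ifP => //= /eqP ->.
by rewrite -{1}(linvK x) pushK // mul_reduced.
Qed.

Lemma mulA u v w : reduced w -> mul (mul u v) w = mul u (mul v w).
Proof. by move=> rw; elim: u => //= x u IH; rewrite mul_push // IH. Qed.

Lemma mul_reduced_cat u v : reduced (u ++ v) -> mul u v = u ++ v.
Proof.
elim: u => //= x u IH; rewrite reduced_cons => /andP[h r]; rewrite IH //.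
by case: (u ++ v) h => //= y w /negbTE ->.
Qed.

Lemma mulw1 v : reduced v -> mul v [::] = v.
Proof. by move=> rv; rewrite mul_reduced_cat cats0. Qed.

Lemma winv_cons x u : winv (x :: u) = rcons (winv u) (linv x).
Proof. by rewrite /winv /= rev_cons. Qed.

Lemma winvK : involutive (@winv n).
Proof. by move=> u; rewrite /winv map_rev revK mapK //; exact: linvK. Qed.

Lemma size_winv u : size (winv u) = size u.
Proof. by rewrite /winv size_rev size_map. Qed.

Lemma mulVK u w : reduced w -> mul (winv u) (mul u w) = w.
Proof.
move=> rw; elim: u => //= x u IH.
by rewrite winv_cons -cats1 mul_cat /= pushK // mul_reduced.
Qed.

Lemma mulKV u w : reduced w -> mul u (mul (winv u) w) = w.
Proof. by move=> rw; rewrite -{1}(winvK u) mulVK. Qed.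

Lemma winv_reduced u : reduced u -> reduced (winv u).
Proof.
elim: u => // x u IH; rewrite reduced_cons winv_cons => /andP[h /IH ru].
rewrite -cats1; apply: (@cat_reduced _ _ (linv x)) => //.
case: u h {IH} ru => [|y u]; first by rewrite /= linvK linv_neq.
rewrite winv_cons last_rcons linvK => h _.
by rewrite eq_sym.
Qed.

Lemma winv_mul u v : reduced u -> reduced v ->
  winv (mul u v) = mul (winv v) (winv u).
Proof.
move=> ru rv; set X := winv _; have rX : reduced X.
  by apply: winv_reduced; exact: mul_reduced.
have e : mul u (mul v X) = [::].
  by rewrite -mulA // -[in mul _ X](mulw1 rX) mulKV.
have := mulVK u (mul_reduced v rX); rewrite e mulw1; last exact: winv_reduced.
by move=> ->; rewrite mulVK.
Qed.

Lemma size_push x w : (size (push x w) <= (size w).+1)%N.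
Proof. by case: w => //= y w; case: ifP => //= _; lia. Qed.

Lemma size_mul_le u v : (size (mul u v) <= size u + size v)%N.
Proof.
by elim: u => //= x u IH; apply: leq_trans (size_push _ _) _; rewrite addSn ltnS.
Qed.

Lemma dX_mul v u w : reduced v -> reduced u -> reduced w ->
  dX (mul v u) (mul v w) = dX u w.
Proof.
move=> rv ru rw; rewrite /dX winv_mul // mulA ?mul_reduced // mulVK //.
Qed.

Lemma dX_sym u v : reduced u -> reduced v -> dX u v = dX v u.
Proof.
by move=> ru rv; rewrite /dX -size_winv winv_mul ?winv_reduced // winvK.
Qed.

Lemma pref_eqP xi eta k :
  pref xi k = pref eta k <-> forall i, (i < k)%N -> xi i = eta i.
Proof.
split=> [e i ik|h].
  by have := congr1 (fun s => nth (xi i) s i) e; rewrite !nth_mkseq.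
apply: (@eq_from_nth _ (xi 0%N)); rewrite !size_mkseq // => i ik.
by rewrite !nth_mkseq // h.
Qed.

Lemma prefS xi k : pref xi k.+1 = xi 0%N :: pref (fun i => xi i.+1) k.
Proof.
rewrite /pref /mkseq /=; congr cons.
by rewrite (iotaDl 1 0) -map_comp.
Qed.

Lemma prefD xi k m : pref xi (k + m) = pref xi k ++ pref (fun i => xi (k + i)%N) m.
Proof.
rewrite /pref /mkseq iotaD map_cat add0n; congr cat.
by rewrite -{1}(addn0 k) iotaDl -map_comp.
Qed.

Lemma prefix_pref xi k m : (k <= m)%N -> prefix (pref xi k) (pref xi m).
Proof. by move=> /subnKC <-; rewrite prefD prefix_prefix. Qed.

Lemma reduced_pref xi k : reduced_ray xi -> reduced (pref xi k).
Proof.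
elim: k xi => // k IH xi r; rewrite prefS reduced_cons IH;
  last by move=> i; exact: r.
by rewrite andbT; case: k {IH} => // k; rewrite prefS; exact: r.
Qed.

Lemma bpush_reduced x xi : reduced_ray xi -> reduced_ray (bpush x xi).
Proof.
by move=> r; rewrite /bpush; case: ifP => [_ k|h [|k]] //; rewrite ?h //; exact: r.
Qed.

Lemma bact_reduced g xi : reduced_ray xi -> reduced_ray (bact g xi).
Proof. by move=> r; elim: g => //= x g; exact: bpush_reduced. Qed.

Lemma bpushK x xi : reduced_ray xi -> bpush (linv x) (bpush x xi) = xi.
Proof.
move=> r; apply: funext => k; rewrite /bpush.
have [e|e] := eqVneq (xi 0%N) (linv x); last by rewrite linvK eqxx.
by rewrite -e (negbTE (r 0%N)); case: k.
Qed.

Lemma bact_push x g xi : reduced_ray xi ->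
  bact (push x g) xi = bpush x (bact g xi).
Proof.
move=> r; case: g => //= y g; case: ifP => //= /eqP ->.
by rewrite -{1}(linvK x) bpushK //; exact: bact_reduced.
Qed.

Lemma bact_mul u v xi : reduced_ray xi -> bact (mul u v) xi = bact u (bact v xi).
Proof. by move=> r; elim: u => //= x u IH; rewrite bact_push // IH. Qed.

Lemma bact_cat u v xi : bact (u ++ v) xi = bact u (bact v xi).
Proof. exact: foldr_cat. Qed.

Lemma bactVK g xi : reduced_ray xi -> bact (winv g) (bact g xi) = xi.
Proof.
move=> r; elim: g => //= x g IH.
by rewrite winv_cons -cats1 bact_cat /= bpushK //; exact: bact_reduced.
Qed.

Lemma bactKV g xi : reduced_ray xi -> bact g (bact (winv g) xi) = xi.
Proof. by move=> r; rewrite -{1}(winvK g) bactVK. Qed.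

Lemma bpush_pref x xi eta k :
  pref xi k.+1 = pref eta k.+1 -> pref (bpush x xi) k = pref (bpush x eta) k.
Proof.
move=> /pref_eqP h; apply/pref_eqP => i ik; rewrite /bpush -(h 0%N) //.
by case: ifP => _; [|case: i ik => // i ik]; apply: h; lia.
Qed.

(** Each letter of [g] costs at most one known letter of the end, so the action on the boundary is
    uniformly continuous with an explicit modulus. *)
Lemma bact_pref g xi eta k : pref xi (k + size g) = pref eta (k + size g) ->
  pref (bact g xi) k = pref (bact g eta) k.
Proof.
elim: g k => [|x g IH] k /=; first by rewrite addn0.
by move=> h; apply: bpush_pref; apply: IH; rewrite addSn -addnS.
Qed.

Lemma push_prefix x xi k w :
  prefix (pref xi k.+1) w -> prefix (pref (bpush x xi) k) (push x w).
Proof.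
rewrite prefS; case: w => // y w; rewrite prefix_cons => /andP[/eqP <- h].
rewrite /bpush /=; case: ifP => // _; case: k h => // k h.
rewrite prefS prefix_cons eqxx andTb; case: k h => // k h.
rewrite prefS prefix_cons eqxx andTb; apply: prefix_trans h.
by apply: prefix_pref; lia.
Qed.

Lemma mul_prefix g xi k w : prefix (pref xi (k + size g)) w ->
  prefix (pref (bact g xi) k) (mul g w).
Proof.
elim: g k => [|x g IH] k /=; first by rewrite addn0.
by move=> h; apply: push_prefix; apply: IH; rewrite addSn -addnS.
Qed.

Lemma mul_converges g h xi : converges_to h xi ->
  converges_to (fun i => mul g (h i)) (bact g xi).
Proof.
move=> c k; have [m hm] := c (k + size g)%N.
by exists m => i mi; apply: mul_prefix; exact: hm.
Qed.

Lemma bact_head x w xi : reduced (x :: w) -> xi 0%N != linv (last x w) ->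
  bact (x :: w) xi 0%N = x.
Proof.
elim: w x => [|y w IH] x; first by rewrite /= /bpush => _ /negbTE ->.
rewrite reduced_cons => /andP[yx r] l.
have h : bact (y :: w) xi 0%N = y by apply: IH.
by rewrite -[LHS]/(bpush x (bact (y :: w) xi) 0%N) /bpush h (negbTE yx).
Qed.

Lemma dX_pref xi i j : reduced_ray xi -> (i <= j)%N ->
  dX (pref xi i) (pref xi j) = (j - i)%N.
Proof.
move=> r ij; rewrite /dX -{1}(subnKC ij) prefD -mul_reduced_cat; last first.
  by rewrite -prefD reduced_pref.
rewrite mulVK ?size_mkseq // reduced_pref // => k.
by rewrite addnS; exact: r.
Qed.

(** Different first letters leave nothing to cancel between the inverse of one prefix and the other:
    the geodesic passes through the identity. *)
Lemma dX_pref_div xi eta i j : reduced_ray xi -> reduced_ray eta ->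
  xi 0%N <> eta 0%N -> dX (pref xi i) (pref eta j) = (i + j)%N.
Proof.
move=> r r' ne; rewrite /dX mul_reduced_cat ?size_cat ?size_winv ?size_mkseq //.
apply: (@cat_reduced _ _ (eta 0%N)); rewrite ?winv_reduced ?reduced_pref //.
case: j => // j; rewrite prefS; case: i => [|i].
  by rewrite /= eq_sym linv_neq.
by rewrite prefS winv_cons last_rcons linvK eq_sym; exact/eqP.
Qed.

End FreeGroup.

(** * Convex hulls *)

Section ConvexHull.
Variable n : nat.
Implicit Types (x y a b : letter n) (u v w g : word n) (xi eta : bseq n).
Implicit Types (S : set (bseq n)) (T : set (word n)).

(* If both ends of the line left [v] by the same edge, the distance between its
   points at times [m] and [- m] would be at most [2 * m - 2]. *)
Lemma Conv_directions S v : S `<=` @reduced_ray n -> Conv S v ->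
  exists xi eta, [/\ S xi, S eta &
    bact (winv v) xi 0%N <> bact (winv v) eta 0%N].
Proof.
move=> Sr [xi [eta [Sxi Seta _ [g [[gr gd] c1 c2 [i0 gv]]]]]].
exists xi, eta; split=> // e.
have rv : reduced v by rewrite -gv.
have [m1 h1] := mul_converges (winv v) c1 1%N.
have [m2 h2] := mul_converges (winv v) c2 1%N.
(* With [m] at least $|i_0|$, the point $v = g(i_0)$ is at distances $m - i_0$ and $m + i_0$ from
   $g(m)$ and $g(-m)$; a common first edge would shorten the total $2m$ by two. *)
pose m := (m1 + m2 + absz i0)%N.
have {}h1 : prefix (pref (bact (winv v) xi) 1) (mul (winv v) (g (Posz m))).
  by apply: h1; rewrite /m; lia.
have {}h2 : prefix (pref (bact (winv v) eta) 1) (mul (winv v) (g (- Posz m)%R)).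
  by apply: h2; rewrite /m; lia.
have rw := winv_reduced rv.
have s1 : size (mul (winv v) (g (Posz m))) = absz (i0 - Posz m)%R.
  by rewrite -gd gv.
have s2 : size (mul (winv v) (g (- Posz m)%R)) = absz (i0 + Posz m)%R.
  by rewrite -[X in absz (_ + X)%R]opprK -gd gv.
have d : dX (mul (winv v) (g (Posz m))) (mul (winv v) (g (- Posz m)%R)) =
         absz (Posz m - - Posz m)%R by rewrite dX_mul.
move: h1 h2 s1 s2 d; rewrite !prefS -e.
case: (mul _ _) => // y u; rewrite prefix_cons => /andP[/eqP <- _].
case: (mul _ _) => // z u'; rewrite prefix_cons => /andP[/eqP <- _] /=.
set a := bact _ _ _; rewrite /dX winv_cons -cats1 mul_cat /= linvK eqxx.
have := size_mul_le (winv u) u'; rewrite size_winv => l s1 s2 d.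
move: l; rewrite d; move: s1 s2; rewrite /m; lia.
Qed.

(** After moving [v] to the identity the two ends begin with different letters, so their rays glue
    to a geodesic line, which [v] carries back. *)
Lemma directions_Conv S v : S `<=` @reduced_ray n -> reduced v ->
  (exists xi eta, [/\ S xi, S eta &
    bact (winv v) xi 0%N <> bact (winv v) eta 0%N]) -> Conv S v.
Proof.
move=> Sr rv [xi [eta [Sxi Seta ne]]].
exists xi, eta; split=> //; first by move=> e; apply: ne; rewrite e.
have r1 := bact_reduced (winv v) (Sr _ Sxi).
have r2 := bact_reduced (winv v) (Sr _ Seta).
set X := bact (winv v) xi in ne r1; set Y := bact (winv v) eta in ne r2.
(* [Negz k] stands for $-(k+1)$, hence the prefix of length [k.+1]; time 0 is the identity. *)
pose p (i : int) := match i with Posz k => pref X k | Negz k => pref Y k.+1 end.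
have pr i : reduced (p i) by case: i => k; exact: reduced_pref.
have pN (k : nat) : p (- Posz k)%R = pref Y k.
  by case: k => [|k] //=; rewrite -NegzE.
have cX : converges_to (fun k : nat => pref X k) X.
  by move=> k; exists k => i; exact: prefix_pref.
have cY : converges_to (fun k : nat => pref Y k) Y.
  by move=> k; exists k => i; exact: prefix_pref.
exists (fun i => mul v (p i)); split.
- split=> [i|i j]; first exact: mul_reduced.
  rewrite dX_mul //.
  case: i j => i [] j; rewrite /p.
  + have [ij|ij] := leqP i j; first by rewrite dX_pref //; lia.
    by rewrite dX_sym ?reduced_pref // dX_pref //; lia.
  + by rewrite dX_pref_div //; lia.
  + by rewrite dX_sym ?reduced_pref // dX_pref_div //; lia.
  + have [ij|ij] := leqP i j; first by rewrite dX_pref //; lia.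
    by rewrite dX_sym ?reduced_pref // dX_pref //; lia.
- by have := mul_converges v cX; rewrite /X bactKV //; exact: Sr.
- have := mul_converges v cY; rewrite /Y bactKV; last exact: Sr.
  move=> c k; have [m hm] := c k; exists m => i mi.
  by rewrite pN; exact: hm.
- by exists 0%R; rewrite /= mulw1.
Qed.

Lemma Conv_sub_reduced S : Conv S `<=` @reduced n.
Proof. by move=> v [xi [eta [_ _ _ [g [[gr _] _ _ [i <-]]]]]]. Qed.

(** Replaces geodesic lines by a condition on the first letters seen from [v]. It involves finitely
    many letters of each end and is the form in which hulls are used below. *)
Lemma ConvP S v : S `<=` @reduced_ray n ->
  Conv S v <-> reduced v /\ exists xi eta, [/\ S xi, S eta &
    bact (winv v) xi 0%N <> bact (winv v) eta 0%N].
Proof.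
move=> Sr; split=> [c|[]]; last exact: directions_Conv.
by split; [exact: Conv_sub_reduced c|exact: Conv_directions].
Qed.

Lemma Conv1P S : S `<=` @reduced_ray n ->
  Conv S [::] <-> exists xi eta, [/\ S xi, S eta & xi 0%N <> eta 0%N].
Proof. by move=> Sr; rewrite ConvP //; split=> [[]|]. Qed.

(* One ray of [S] leaves [u] towards [w], another one towards the identity. *)
Lemma Conv_prefix S u w : S `<=` @reduced_ray n ->
  Conv S [::] -> Conv S (u ++ w) -> Conv S u.
Proof.
move=> Sr c1 c.
have ruw := Conv_sub_reduced c.
have [ru rw] := reduced_cat ruw.
case: w rw c ruw => [|b w] rw c ruw; first by rewrite cats0 in c.
case: u ru c ruw => // a u ru c ruw.
have {c1}[eta Seta etaN] : exists2 eta, S eta & eta 0%N != a.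
  have [xi [eta [Sxi Seta /eqP]]] := (Conv1P Sr).1 c1.
  have [->|] := eqVneq (xi 0%N) a; last by exists xi.
  by rewrite eq_sym; exists eta.
(* At most one of two ends leaving by different edges takes the last edge of the word backwards. *)
have {c}[xi Sxi xiN] : exists2 xi, S xi &
    bact (winv ((a :: u) ++ b :: w)) xi 0%N != linv (last b w).
  have [xi [eta' [Sxi Seta' /eqP]]] := ((ConvP _ Sr).1 c).2.
  set X := bact _ _ _; have [->|] := eqVneq X (linv (last b w)).
    by rewrite eq_sym; exists eta'.
  by exists xi.
apply/ConvP => //; split=> //; exists xi, eta; split=> //.
have -> : bact (winv (a :: u)) xi 0%N = b.
  have rxi := Sr _ Sxi.
  rewrite -(bact_head rw xiN); set z := bact (winv (_ ++ _)) xi.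
  rewrite -[in LHS](bactKV ((a :: u) ++ b :: w) rxi) -/z bact_cat.
  by rewrite bactVK //; do 2!apply: bact_reduced.
have rw' := winv_reduced ru.
have : bact (winv (a :: u)) eta 0%N = linv (last a u).
  have : winv (a :: u) = linv (last a u) :: winv (belast a u).
    by rewrite lastI /winv map_rcons rev_rcons.
  move=> E; rewrite E in rw' *; apply: bact_head => //.
  rewrite (_ : last _ _ = linv a) ?linvK //.
  have := congr1 (last (linv a)) E; rewrite winv_cons last_rcons /= => ->.
  by [].
move: ruw; rewrite /reduced /= cat_path /= => /and3P[_ /eqP bN _] ->.
exact: bN.
Qed.

End ConvexHull.

(** * The action on closed subsets and on finite subtrees *)

Section Action.
Variable n : nat.
Implicit Types (x y a b : letter n) (u v w g : word n) (xi eta : bseq n).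
Implicit Types (S : CN n) (T : set (word n)).

Lemma CN_ext S S' : cset S = cset S' -> S = S'.
Proof.
case: S S' => A cA tA [B cB tB] /= e; subst B.
by rewrite (Prop_irrelevance cA cB) (Prop_irrelevance tA tB).
Qed.

Lemma cset_reduced S : cset S `<=` @reduced_ray n.
Proof. by case: S => A []. Qed.

Lemma bact_closed g (A : set (bseq n)) : closed_bd A -> closed_bd (bact g @` A).
Proof.
move=> [Ar Ac]; split=> [_ [xi Axi <-]|xi rxi h].
  by apply: bact_reduced; exact: Ar.
exists (bact (winv g) xi); last exact: bactKV.
apply: Ac; first exact: bact_reduced.
move=> k; have [_ [[eta Aeta <-] e]] := h (k + size (winv g))%N.
exists eta; split=> //.
by rewrite -(bact_pref e) bactVK //; exact: Ar.
Qed.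

Lemma bact_two g S : exists xi eta,
  (bact g @` cset S) xi /\ (bact g @` cset S) eta /\ xi <> eta.
Proof.
have [xi [eta [Sxi [Seta ne]]]] := cset_two S.
exists (bact g xi), (bact g eta); split; first by exists xi.
split; first by exists eta.
move=> /(congr1 (bact (winv g))); rewrite !bactVK //.
- exact: cset_reduced Seta.
- exact: cset_reduced Sxi.
Qed.

(** The action as a map from $\mathcal{C}_N$ to itself, so that [act_preimage] becomes an ordinary
    preimage. *)
Definition gact g S : CN n :=
  mkCN (bact_closed g (cset_closed S)) (bact_two g S).

Lemma act_preimageE g (A : set (CN n)) : act_preimage g A = gact g @^-1` A.
Proof.
apply/seteqP; split=> S /=.
  by move=> [S' AS' e]; rewrite (_ : gact g S = S') //; exact: CN_ext.
by exists (gact g S).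
Qed.

Lemma levelset_gact g k S S' : levelset (k + size g) S' = levelset (k + size g) S ->
  levelset k (gact g S') = levelset k (gact g S).
Proof.
suff H S1 S2 : levelset (k + size g) S1 = levelset (k + size g) S2 ->
    levelset k (gact g S1) `<=` levelset k (gact g S2).
  by move=> e; apply/seteqP; split; apply: H.
move=> e _ [_ [xi S1xi <-] <-].
have : levelset (k + size g) S1 (pref xi (k + size g)) by exists xi.
rewrite e => -[eta S2eta /bact_pref h].
by exists (bact g eta) => //; exists eta.
Qed.

Lemma tact_reduced g T : T `<=` @reduced n -> tact g T `<=` @reduced n.
Proof. by move=> Tr _ [v Tv <-]; apply: mul_reduced; exact: Tr. Qed.

Lemma tactVK g T : T `<=` @reduced n -> tact (winv g) (tact g T) = T.
Proof.
move=> Tr; apply/seteqP; split=> [_ [_ [v Tv <-] <-]|v Tv].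
  by rewrite mulVK //; exact: Tr.
by exists (mul g v); [exists v|rewrite mulVK //; exact: Tr].
Qed.

Lemma tactKV g T : T `<=` @reduced n -> tact g (tact (winv g) T) = T.
Proof. by move=> Tr; rewrite -{1}(winvK g) tactVK. Qed.

Lemma tactM g h T : T `<=` @reduced n -> tact (mul g h) T = tact g (tact h T).
Proof.
move=> Tr; apply/seteqP; split=> [_ [v Tv <-]|_ [_ [v Tv <-] <-]].
  by exists (mul h v); [exists v|rewrite mulA //; exact: Tr].
by exists v => //; rewrite mulA //; exact: Tr.
Qed.

Lemma tactI g T T' : T `<=` @reduced n -> T' `<=` @reduced n ->
  tact g (T `&` T') = tact g T `&` tact g T'.
Proof.
move=> Tr Tr'; apply/seteqP; split=> [_ [v [Tv Tv'] <-]|v [[u Tu <-] [u' Tu']]].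
  by split; exists v.
move=> /(congr1 (mul (winv g))); rewrite !mulVK; try by [exact: Tr|exact: Tr'].
by move=> e; exists u => //; split=> //; rewrite -e.
Qed.

(** Seen from $gv$, the end $g\xi$ starts with the same letter as $\xi$ seen from $v$, because
    $(gv)^{-1}g = v^{-1}$. *)
Lemma Conv_bact g (A : set (bseq n)) : reduced g -> A `<=` @reduced_ray n ->
  Conv (bact g @` A) = tact g (Conv A).
Proof.
move=> rg Ar; have gAr : bact g @` A `<=` @reduced_ray n.
  by move=> _ [xi Axi <-]; apply: bact_reduced; exact: Ar.
apply/seteqP; split=> [v|_ [u cu <-]].
  move=> /(ConvP _ gAr)[rv [_ [_ [[xi Axi <-] [eta Aeta <-]] ne]]].
  exists (mul (winv g) v); last exact: mulKV.
  apply/ConvP => //; split; first exact: mul_reduced.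
  exists xi, eta; split=> //.
  rewrite winv_mul // ?winv_reduced // winvK.
  by rewrite !bact_mul //; exact: Ar.
have [ru [xi [eta [Axi Aeta ne]]]] := (ConvP _ Ar).1 cu.
apply/ConvP => //; split; first exact: mul_reduced.
exists (bact g xi), (bact g eta); split; [by exists xi|by exists eta|].
rewrite winv_mul // !bact_mul; try by apply: bact_reduced; exact: Ar.
by rewrite !bactVK //; exact: Ar.
Qed.

Lemma Conv_gact g S : reduced g -> Conv (cset (gact g S)) = tact g (Conv (cset S)).
Proof. by move=> rg; apply: Conv_bact => //; exact: cset_reduced. Qed.

Lemma RR_tact g T : reduced g -> T `<=` @reduced n ->
  RR (tact g T) = [set p | RR T (gact (winv g) p.1, gact (winv g) p.2)].
Proof.
move=> rg Tr; apply/seteqP; split=> -[S1 S2]; rewrite /RR /=;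
  rewrite !Conv_gact ?winv_reduced // -tactI; try exact: Conv_sub_reduced.
  by move=> ->; rewrite tactVK.
move=> <-; rewrite tactKV // => v [+ _]; exact: Conv_sub_reduced.
Qed.

Lemma finite_words_bounded T : finite_set T ->
  exists M, forall t, T t -> (size t <= M)%N.
Proof.
move=> /finite_seqP[s ->]; exists (\max_(t <- s) size t)%N => t /= ts.
exact: (@leq_bigmax_seq _ s xpredT (fun t : word n => size t) t ts isT).
Qed.

(** [g] is the product of $gt$ and the inverse of $t$, and both $t$ and $gt$ lie in the bounded set
    [T]. *)
Lemma stabilizer_bounded T g t M : T `<=` @reduced n -> T t -> reduced g ->
  (forall t, T t -> (size t <= M)%N) -> tact g T = T -> (size g <= M + M)%N.
Proof.
move=> Tr Tt rg bM gT; have rt := Tr _ Tt.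
have -> : g = mul (mul g t) (winv t).
  rewrite mulA ?winv_reduced // -[X in mul t X](mulw1 (winv_reduced rt)).
  by rewrite mulKV // mulw1.
apply: leq_trans (size_mul_le _ _) _; rewrite size_winv leq_add // ?bM //.
by rewrite -gT; exists t.
Qed.

(* Squaring a cyclically reduced word doubles its length. *)
Lemma stabilizer_unbounded T x w k : T `<=` @reduced n ->
  reduced (x :: w) -> x != linv (last x w) -> tact (x :: w) T = T ->
  exists w', [/\ (k <= size w')%N, reduced (x :: w') & tact (x :: w') T = T].
Proof.
move=> Tr r c s.
suff [w' [h1 h2 h3 _]] : exists w', [/\ (k <= size w')%N, reduced (x :: w'),
    tact (x :: w') T = T & last x w' = last x w] by exists w'.
elim: k => [|k [w' [h1 h2 h3 h4]]]; first by exists w.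
exists (w' ++ x :: w'); split.
- by rewrite size_cat /=; lia.
- by rewrite -cat_cons; apply: (@cat_reduced _ _ _ x); rewrite //= h4.
- rewrite -cat_cons -mul_reduced_cat ?tactM ?h3 //.
  by apply: (@cat_reduced _ _ _ x); rewrite //= h4.
- by rewrite last_cat.
Qed.

(** Induction on the length of [g]. A nonempty cyclically reduced [g] would give arbitrarily long
    elements of the stabilizer. Otherwise $g = xhx^{-1}$, and the shorter word [h] fixes $x^{-1}T$,
    which is why [T] varies in the induction; then [h] is empty and [g] is not reduced. *)
Lemma stabilizer_trivial T g : finite_set T -> T !=set0 -> T `<=` @reduced n ->
  reduced g -> tact g T = T -> g = [::].
Proof.
move: {2}(size g) (leqnn (size g)) => N.
elim: N g T => [|N IH] [|x w] T //= sz fT nT Tr rg gT.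
have [e|c] := eqVneq x (linv (last x w)); last first.
  have [M bM] := finite_words_bounded fT; have [t Tt] := nT.
  have [w' [h1 h2 h3]] := stabilizer_unbounded (M + M) Tr rg c gT.
  by have := stabilizer_bounded Tr Tt h2 bM h3; rewrite /=; lia.
case/lastP: w e rg gT sz => [|h z] /=.
  by move=> /esym/eqP; rewrite (negbTE (linv_neq _)).
rewrite last_rcons => e rg gT sz.
have rh : reduced h.
  move: rg; rewrite reduced_cons -cats1 => /andP[_ /reduced_cat[] //].
have zE : z = linv x by rewrite e linvK.
suff h0 : h = [::] by move: rg; rewrite h0 zE reduced_cons /= eqxx.
apply: (IH h (tact [:: linv x] T)) => //.
- by move: sz; rewrite size_rcons; lia.
- exact: finite_image.
- by case: nT => t Tt; exists (mul [:: linv x] t); exists t.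
- exact: tact_reduced.
rewrite -tactM // -[in RHS]gT -tactM //.
rewrite -[mul [:: linv x] _]/(push (linv x) (x :: rcons h z)) /= linvK eqxx.
rewrite mul_reduced_cat -zE cats1 //.
by move: rg; rewrite reduced_cons => /andP[].
Qed.

End Action.

(** * Level sets and compactness *)

Section Levels.
Variable n : nat.
Implicit Types (u v w g : word n) (xi eta : bseq n) (S : CN n) (A : set (CN n)).

(** Level sets are encoded in a finite type, so that one can sum over them and an ultrafilter can
    select one of them. *)
Definition level_pattern k S : {set k.-tuple (letter n)} :=
  finset (fun t : k.-tuple (letter n) => `[< levelset k S (tval t) >]).

Lemma level_patternP k S S' :
  level_pattern k S = level_pattern k S' <-> levelset k S = levelset k S'.
Proof.
split=> [e|e]; last by rewrite /level_pattern e.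
suff H S1 S2 : level_pattern k S1 = level_pattern k S2 ->
    levelset k S1 `<=` levelset k S2 by apply/seteqP; split; apply: H.
move=> {}e _ [xi Sxi <-].
have sz : size (pref xi k) == k by rewrite size_mkseq.
have : Tuple sz \in level_pattern k S1 by rewrite inE; apply/asboolP; exists xi.
by rewrite e inE => /asboolP.
Qed.

(** Unions of Hausdorff balls of one radius. The complement has the same form, so these sets are
    clopen. *)
Definition level_determined k A :=
  forall S S', levelset k S' = levelset k S -> A S -> A S'.

Lemma level_determinedC k A : level_determined k A -> level_determined k (~` A).
Proof. by move=> d S S' e nA /(d S' S (esym e)). Qed.

Lemma level_determined_open k A : level_determined k A -> open A.
Proof.
move=> d; rewrite -[open]/(@CN_open n) => S AS.
by exists k => S' e; exact: d AS.
Qed.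

Lemma level_determined_measurable k A : level_determined k A -> measurable A.
Proof.
by move=> d; apply: sub_sigma_algebra; exact: level_determined_open d.
Qed.

Lemma level_pattern_determined k (p : {set k.-tuple (letter n)}) :
  level_determined k [set S | level_pattern k S = p].
Proof. by move=> S S' e /= <-; apply/level_patternP. Qed.

(** By [bact_pref], the first letter of $v^{-1}\xi$ is determined by the first $|v|+1$ letters of
    $\xi$. *)
Lemma Conv_level_determined v k : (size v < k)%N ->
  level_determined k [set S | Conv (cset S) v].
Proof.
move=> vk S S' e /= /(ConvP _ (@cset_reduced n S))[rv [xi [eta [Sxi Seta ne]]]].
apply/ConvP; first exact: cset_reduced.
have {}e : levelset (1 + size (winv v)) S' = levelset (1 + size (winv v)) S.
  by apply: levelset_le e; rewrite size_winv.
have lift zeta : cset S zeta -> exists2 zeta', cset S' zeta' &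
    bact (winv v) zeta' 0%N = bact (winv v) zeta 0%N.
  move=> Sz; have : levelset (1 + size (winv v)) S (pref zeta (1 + size (winv v))).
    by exists zeta.
  rewrite -e => -[zeta' Sz' /bact_pref h]; exists zeta' => //.
  by move/pref_eqP: h; apply.
split=> //; have [xi' Sxi' exi] := lift _ Sxi.
have [eta' Seta' eeta] := lift _ Seta.
by exists xi', eta'; split=> //; rewrite exi eeta.
Qed.

Definition hull_at_origin : set (CN n) := [set S | Conv (cset S) [::]].

Lemma RR_sub_origin (T : set (word n)) S1 S2 : T [::] -> RR T (S1, S2) ->
  hull_at_origin S1 /\ hull_at_origin S2.
Proof. by move=> + e; rewrite -e => -[]. Qed.

(* The intersection of the two hulls is convex, so it leaves the ball of radius
   [L] only through the sphere of radius [L.+1]. *)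
Lemma RR_level_determined (T : set (word n)) L S1 S2 S1' S2' :
  T [::] -> (forall t, T t -> (size t <= L)%N) ->
  levelset L.+2 S1' = levelset L.+2 S1 -> levelset L.+2 S2' = levelset L.+2 S2 ->
  RR T (S1, S2) -> RR T (S1', S2').
Proof.
move=> T1 TL e1 e2 /[dup] rr; rewrite /RR /= => E.
have inball v : (size v <= L.+1)%N ->
    (Conv (cset S1') `&` Conv (cset S2')) v <-> T v.
  move=> vL; rewrite -E; split=> -[c1 c2]; split;
    by [exact: (@Conv_level_determined v L.+2 _ S1 S1')
       |exact: (@Conv_level_determined v L.+2 _ S1' S1)
       |exact: (@Conv_level_determined v L.+2 _ S2 S2')
       |exact: (@Conv_level_determined v L.+2 _ S2' S2)].
apply/seteqP; split=> [v [c1 c2]|t Tt]; last first.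
  by apply/inball => //; apply: leqW; exact: TL.
have [vL|vL] := leqP (size v) L.+1; first exact/inball.
have [c01 c02] : (Conv (cset S1') `&` Conv (cset S2')) [::] by apply/inball.
have sz : size (take L.+1 v) = L.+1 by rewrite size_take vL.
suff /TL : T (take L.+1 v) by rewrite sz ltnn.
apply/inball; rewrite ?sz //.
by split; apply: (@Conv_prefix _ _ _ (drop L.+1 v)); rewrite ?cat_take_drop //;
  exact: cset_reduced.
Qed.

(** * Limits of compatible sequences of level sets *)

Section Limit.
Variable Sk : nat -> CN n.
Hypothesis Sk_compat : forall j k, (j <= k)%N -> levelset j (Sk k) = levelset j (Sk j).
Hypothesis Sk_origin : hull_at_origin (Sk 1%N).

Let Sl : set (bseq n) :=
  [set xi | reduced_ray xi /\ forall k, levelset k (Sk k) (pref xi k)].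

(** A diagonal construction: [e i] lies in [Sk (k + i)] and [e i.+1] keeps its first [k + i]
    letters, so the letters stabilize to an end of the limit set. *)
Lemma limit_levelset k w : levelset k (Sk k) w ->
  exists2 xi, Sl xi & pref xi k = w.
Proof.
move=> [eta0 Seta0 <-].
pose Q i eta := [set eta' | cset (Sk (k + i).+1) eta' /\
  pref eta' (k + i) = pref eta (k + i)].
pose next i eta := xget eta (Q i eta).
pose e := fix e i := if i is j.+1 then next j (e j) else eta0.
have nextP i eta : cset (Sk (k + i)) eta -> Q i eta (next i eta).
  move=> Se; apply: xgetPex.
  have : levelset (k + i) (Sk (k + i)) (pref eta (k + i)) by exists eta.
  by rewrite -(@Sk_compat _ (k + i).+1) // => -[eta' ? ?]; exists eta'.
have eS i : cset (Sk (k + i)) (e i).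
  by elim: i => [|i /nextP[]]; rewrite ?addn0 ?addnS.
have estep i : pref (e i.+1) (k + i) = pref (e i) (k + i).
  by have [] := nextP i _ (eS i).
have est i j m : (i <= j)%N -> (m < k + i)%N -> e j m = e i m.
  move=> ij mk; rewrite -(subnKC ij); elim: (j - i)%N => [|d IH]; rewrite ?addn0 //.
  rewrite -IH addnS; move/pref_eqP: (estep (i + d)%N); apply; lia.
(* Letter [m] is frozen from stage [m.+1] on for every [k]; when [k] is 0, stage [m] would be too
   early. *)
pose xi m := e m.+1 m.
have xiE i : pref xi (k + i) = pref (e i) (k + i).
  apply/pref_eqP => m mk; rewrite /xi.
  by have [im|im] := leqP i m.+1; [|symmetry]; apply: est => //; lia.
have xiE' i j : (j <= k + i)%N -> pref xi j = pref (e i) j.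
  move=> jk; apply/pref_eqP => m mj; move/pref_eqP: (xiE i); apply; lia.
exists xi; last by rewrite (@xiE' 0%N) ?addn0.
split=> [i|j].
  have /pref_eqP h := @xiE' i.+2 i.+2 (leq_addl _ _).
  by rewrite !h //; apply: cset_reduced (eS i.+2) _.
rewrite (xiE' j) ?leq_addl // -(@Sk_compat _ (k + j)%N) ?leq_addl //.
by exists (e j).
Qed.

Lemma limit_closed : closed_bd Sl.
Proof.
split=> [xi []|xi r h] //; split=> // k.
by have [eta [[_ H] <-]] := h k; exact: H.
Qed.

(** A hull through the identity keeps the limit from shrinking to one point: two different first
    letters survive from level 1. *)
Lemma limit_directions : exists xi eta, [/\ Sl xi, Sl eta & xi 0%N <> eta 0%N].
Proof.
have [xi [eta [Sxi Seta ne]]] := (Conv1P (@cset_reduced n _)).1 Sk_origin.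
have [|xi' Sxi' /pref_eqP exi] := @limit_levelset 1 (pref xi 1); first by exists xi.
have [|eta' Seta' /pref_eqP eeta] := @limit_levelset 1 (pref eta 1); first by exists eta.
by exists xi', eta'; split=> //; rewrite exi // eeta.
Qed.

Lemma limit_CN : exists2 S, hull_at_origin S &
  forall k, levelset k S = levelset k (Sk k).
Proof.
have [xi [eta [Sxi Seta ne]]] := limit_directions.
have two : exists xi eta, Sl xi /\ Sl eta /\ xi <> eta.
  by exists xi, eta; split=> //; split=> // e; apply: ne; rewrite e.
exists (mkCN limit_closed two).
  by apply/Conv1P; [exact: cset_reduced|exists xi, eta].
move=> k; apply/seteqP; split=> w; last by move=> /limit_levelset[zeta ? <-]; exists zeta.
by move=> [zeta [_ h] <-]; exact: h.
Qed.

End Limit.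

Lemma ultra_finite_value (X : Type) (I : eqType) (f : X -> I)
    (F : set_system X) (s : seq I) : UltraFilter F ->
  F [set x | f x \in s] -> exists p, F [set x | f x = p].
Proof.
move=> FU; elim: s => [|p s IH].
  rewrite (_ : [set _ | _] = set0); last by apply/seteqP; split.
  by move=> /filter_ex[].
move=> Fs; have [h|h] := in_ultra_setVsetC [set x | f x = p] FU; first by exists p.
apply: IH; apply: filterS (filterI Fs h) => x /= [].
by rewrite in_cons => /orP[/eqP|].
Qed.

(** Each level has finitely many patterns, so an ultrafilter singles out one. The chosen patterns
    are compatible because two sets of the filter meet, and the closed set that they define is a
    limit of the ultrafilter. *)
Lemma compact_hull_at_origin : compact hull_at_origin.
Proof.
rewrite compact_ultra => F FU FK.
have /choice[Sk SkP] : forall k, exists S,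
    hull_at_origin S /\ F [set S' | levelset k S' = levelset k S].
  move=> k.
  have [|p Fp] := @ultra_finite_value _ _ (level_pattern k) F
    (enum {set k.-tuple (letter n)}) FU.
    by apply: filterS filterT => S _ /=; rewrite mem_enum.
  have [S [KS pS]] := filter_ex (filterI FK Fp).
  exists S; split=> //; apply: filterS Fp => S' /= pS'.
  by apply/level_patternP; rewrite pS' pS.
have compat j k : (j <= k)%N -> levelset j (Sk k) = levelset j (Sk j).
  move=> jk; have [S [/= ej ek]] := filter_ex (filterI (SkP j).2 (SkP k).2).
  by rewrite -ej -(levelset_le jk ek).
have [S KS Slev] := limit_CN compat (SkP 1%N).1.
exists S; split=> // U; rewrite /= nbhsE => -[V [oV VS] VU].
have [k kV] : exists k, forall S', levelset k S' = levelset k S -> V S'.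
  exact: (oV : CN_open V) S VS.
apply: filterS (SkP k).2 => S' /= e; apply: VU; apply: kV.
by rewrite Slev.
Qed.

Lemma level_determined_compact k A : level_determined k A ->
  A `<=` hull_at_origin -> compact A.
Proof.
move=> d; apply: subclosed_compact compact_hull_at_origin.
rewrite -[A]setCK; apply: open_closedC.
exact: level_determined_open (level_determinedC d).
Qed.

End Levels.

Local Open Scope ring_scope.
Local Open Scope ereal_scope.

(** * Measures of finite-level sets *)

Section StepFunctions.
Context d1 (T1 : measurableType d1) (R : realType).
Variable m1 : {measure set T1 -> \bar R}.

Lemma integral_steps (I : finType) (w : I -> R) (B : I -> set T1) :
  (forall i, (0 <= w i)%R) -> (forall i, measurable (B i)) ->
  \int[m1]_x ((\sum_i w i * \1_(B i) x)%R)%:E = \sum_i (w i)%:E * m1 (B i).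
Proof.
move=> w0 mB; under eq_integral do rewrite -sumEFin.
rewrite ge0_integral_sum //=.
- apply: eq_bigr => i _; under eq_integral do rewrite EFinM.
  rewrite ge0_integralZl_EFin //=; first by rewrite integral_indic // setIT.
  by apply/measurable_EFinP; exact: measurable_indic (mB i).
- move=> i; apply/measurable_EFinP; exact: measurable_funM.
- by move=> i x _; rewrite lee_fin mulr_ge0.
Qed.

(** Both sides are integrals of the same step function; this takes the place of separate
    disjointness and additivity arguments. *)
Lemma measure_steps (I : finType) (w : I -> R) (B : I -> set T1) (A : set T1) :
  measurable A -> (forall i, (0 <= w i)%R) -> (forall i, measurable (B i)) ->
  (forall x, \1_A x = (\sum_i w i * \1_(B i) x)%R) ->
  m1 A = \sum_i (w i)%:E * m1 (B i).
Proof.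
move=> mA w0 mB AE; rewrite -integral_steps // -[in LHS](setIT A) -integral_indic //.
by apply: eq_integral => x _; rewrite AE.
Qed.

End StepFunctions.

Section ProductSteps.
Context d1 d2 (T1 : measurableType d1) (T2 : measurableType d2) (R : realType).
Variables (m1 : {measure set T1 -> \bar R}) (m2 : {measure set T2 -> \bar R}).

(** The product measure is by definition the integral of the measures of the sections. Each section
    is resolved into the sets [C j], and the resulting function of [x] is a step function over the
    [B i]. *)
Lemma product_measure1_steps (I J : finType) (c : I -> J -> R)
    (B : I -> set T1) (C : J -> set T2) (E : set (T1 * T2)) :
  (forall i j, (0 <= c i j)%R) ->
  (forall i, measurable (B i)) -> (forall j, measurable (C j)) ->
  (forall i, m1 (B i) < +oo) -> (forall j, m2 (C j) < +oo) ->
  (forall x, measurable (xsection E x)) ->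
  (forall x y, \1_E (x, y) = (\sum_i \sum_j c i j * (\1_(B i) x * \1_(C j) y))%R) ->
  (m1 \x m2) E =
  ((\sum_i \sum_j c i j * (fine (m1 (B i)) * fine (m2 (C j))))%R)%:E.
Proof.
move=> c0 mB mC fB fC mE EE.
have finB i : (fine (m1 (B i)))%:E = m1 (B i).
  by rewrite fineK // ge0_fin_numE.
have finC j : (fine (m2 (C j)))%:E = m2 (C j).
  by rewrite fineK // ge0_fin_numE.
rewrite /product_measure1.
transitivity (\int[m1]_x ((\sum_i (\sum_j c i j * fine (m2 (C j))) * \1_(B i) x)%R)%:E).
  apply: eq_integral => x _ /=.
  rewrite (@measure_steps _ _ _ _ J (fun j => \sum_i c i j * \1_(B i) x)%R C) //.
  - under [LHS]eq_bigr do rewrite -finC -EFinM.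
    rewrite sumEFin; congr (_%:E).
    under [RHS]eq_bigr do rewrite mulr_suml.
    rewrite exchange_big /=; apply: eq_bigr => j _.
    by rewrite mulr_suml; apply: eq_bigr => i _; rewrite mulrAC.
  - by move=> j; apply: sumr_ge0 => i _; rewrite mulr_ge0.
  - move=> y; rewrite indicE mem_xsection -indicE EE exchange_big /=.
    apply: eq_bigr => j _; rewrite mulr_suml.
    by apply: eq_bigr => i _; rewrite mulrA.
rewrite integral_steps //; last first.
  by move=> i; apply: sumr_ge0 => j _; rewrite mulr_ge0 // fine_ge0.
under eq_bigr do rewrite -finB -EFinM.
rewrite sumEFin; congr (_%:E); apply: eq_bigr => i _.
by rewrite mulr_suml; apply: eq_bigr => j _; rewrite mulrAC mulrA.
Qed.

End ProductSteps.

(** * Masses of cells and the measure of [RR T] *)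

Section Masses.
Variables (R : realType) (n : nat).
Implicit Types (mu nu : {measure set (CN n) -> \bar R}).
Implicit Types (S : CN n) (T : set (word n)) (g : word n).
Local Notation K1 := (@hull_at_origin n).
Local Notation pattern k := {set k.-tuple (letter n)}.

(** For positive [k] these are compact open pieces, some possibly empty, that partition [K1]. *)
Definition cell k (p : pattern k) : set (CN n) :=
  [set S | K1 S /\ level_pattern k S = p].

Definition mass mu k (p : pattern k) : R := fine (mu (cell p)).

Lemma hull_at_origin_determined k : (0 < k)%N -> level_determined k K1.
Proof. exact: (@Conv_level_determined n [::] k). Qed.

Lemma cell_determined k (p : pattern k) : (0 < k)%N -> level_determined k (cell p).
Proof.
move=> k0 S S' e [KS pS]; split; first exact: (hull_at_origin_determined k0 e KS).
exact: (@level_pattern_determined n k p S S').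
Qed.

Lemma gact_determined g k A : level_determined k A ->
  level_determined (k + size g) (gact g @^-1` A).
Proof. by move=> d S S' e /=; apply: d; exact: levelset_gact. Qed.

Lemma SCurr_gact mu g k A : SCurr mu -> reduced g -> level_determined k A ->
  mu (gact g @^-1` A) = mu A.
Proof.
move=> [inv _] rg d; rewrite -act_preimageE inv //.
exact: level_determined_measurable d.
Qed.

Lemma hull_at_origin_finite mu : SCurr mu -> mu K1 < +oo.
Proof. by case=> _; apply; exact: compact_hull_at_origin. Qed.

Lemma cell_finite mu k (p : pattern k) : (0 < k)%N -> SCurr mu -> mu (cell p) < +oo.
Proof.
move=> k0 mS; apply: le_lt_trans (hull_at_origin_finite mS).
apply: le_measure; last by move=> S [].
  by apply/mem_set; exact: (level_determined_measurable (cell_determined k0)).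
by apply/mem_set; exact: (level_determined_measurable (@hull_at_origin_determined 1 _)).
Qed.

Lemma mass_ge0 mu k (p : pattern k) : (0 <= mass mu p)%R.
Proof. exact: fine_ge0. Qed.

(** Only the cell containing [h S] can contribute. The map [h] is later the identity or a
    translation. *)
Lemma sum_cells (h : CN n -> CN n) k (f : pattern k -> R) S :
  (\sum_p f p * \1_(h @^-1` cell p) S)%R =
  (f (level_pattern k (h S)) * \1_(h @^-1` K1) S)%R.
Proof.
rewrite (bigD1 (level_pattern k (h S))) //= big1 ?addr0 => [|p pN].
  congr (_ * _)%R; rewrite !indicE; congr (GRing.natmul _ (nat_of_bool _)).
  by apply/idP/idP => /set_mem hS; apply/mem_set; [case: hS|split].
rewrite indicE memNset ?mulr0 // => -[_ /= e].
by rewrite e eqxx in pN.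
Qed.

(** One witness suffices: once [T] lies in the ball of radius [L], patterns of level [L.+2] decide
    membership in [RR T]. *)
Definition RR_patterns T k (p q : pattern k) : bool :=
  `[< exists S1 S2, [/\ RR T (S1, S2), level_pattern k S1 = p &
                        level_pattern k S2 = q] >].

Lemma RR_patternsP T L S1 S2 : T [::] -> (forall t, T t -> (size t <= L)%N) ->
  reflect (RR T (S1, S2))
    (RR_patterns T (level_pattern L.+2 S1) (level_pattern L.+2 S2)).
Proof.
move=> T1 TL; rewrite /RR_patterns.
apply: (iffP (asboolP _)) => [[S1' [S2' [rr]]]|rr]; last by exists S1, S2.
move=> /level_patternP e1 /level_patternP e2.
by apply: RR_level_determined (esym e1) (esym e2) rr.
Qed.

(** By equivariance of hulls, [RR (tact g T)] is the preimage of [RR T] under $g^{-1}$, and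
    invariance of both currents removes the translation from the cells. The right-hand side is free
    of [g], so translates have equal measure. *)
Lemma RR_measure mu nu T L g : SCurr mu -> SCurr nu -> T `<=` @reduced n ->
  T [::] -> (forall t, T t -> (size t <= L)%N) -> reduced g ->
  (mu \x nu) (RR (tact g T)) =
  ((\sum_p \sum_q (RR_patterns T p q)%:R *
     (@mass mu L.+2 p * @mass nu L.+2 q))%R)%:E.
Proof.
move=> mS nS Tr T1 TL rg; have rg' := winv_reduced rg.
rewrite RR_tact //; set h := gact (winv g).
have cd (p : pattern L.+2) := @cell_determined _ p isT.
have hm k A : level_determined k A -> measurable (h @^-1` A).
  by move=> d; exact: level_determined_measurable (gact_determined d).
rewrite (@product_measure1_steps _ _ _ _ _ _ _ _ _
  (fun p q : pattern L.+2 => (RR_patterns T p q)%:R)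
  (fun p => h @^-1` cell p) (fun q => h @^-1` cell q)).
- congr (_%:E); apply: eq_bigr => p _; apply: eq_bigr => q _.
  by rewrite (SCurr_gact mS rg' (cd p)) (SCurr_gact nS rg' (cd q)).
- by move=> p q; rewrite ler0n.
- by move=> p; apply: hm (cd p).
- by move=> p; apply: hm (cd p).
- by move=> p; rewrite (SCurr_gact mS rg' (cd p)) cell_finite.
- by move=> p; rewrite (SCurr_gact nS rg' (cd p)) cell_finite.
- move=> S; rewrite (_ : xsection _ _ = h @^-1` [set S2 | RR T (h S, S2)]).
    apply: (hm L.+2) => S2 S2' e /=.
    exact: (@RR_level_determined n T L).
  by apply/seteqP; split=> S2; rewrite /xsection /= inE.
- move=> S1 S2.
  have -> : (\sum_p \sum_q (RR_patterns T p q)%:R *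
      (\1_(h @^-1` @cell L.+2 p) S1 * \1_(h @^-1` @cell L.+2 q) S2) =
    \sum_p (\sum_q (RR_patterns T p q)%:R * \1_(h @^-1` @cell L.+2 q) S2) *
      \1_(h @^-1` @cell L.+2 p) S1 :> R)%R.
    apply: eq_bigr => p _; rewrite mulr_suml; apply: eq_bigr => q _.
    by rewrite mulrA mulrAC.
  rewrite (sum_cells h) (sum_cells h) !indicE -!natrM !mulnb.
  congr (GRing.natmul _ (nat_of_bool _)).
  apply/idP/idP => [/set_mem /= rr|/andP[/andP[/RR_patternsP rr _] _]].
    have [k1 k2] := RR_sub_origin T1 rr.
    by rewrite !mem_set // !andbT; apply/RR_patternsP.
  by apply/mem_set; exact: rr.
Qed.

End Masses.

(** * Disjointness and the volume bound *)

Section Star.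
Variable n : nat.
Implicit Types (a b : letter n) (v w : word n) (D : set (letter n)) (S : CN n).

Definition star D : set (word n) :=
  [set v | v = [::] \/ exists2 a, D a & v = [:: a]].

Definition first_letters S : set (letter n) := [set xi 0%N | xi in cset S].

Lemma star_letter D a : star D [:: a] <-> D a.
Proof. by split=> [[//|[b Db [->]]]|Da]; [|right; exists a]. Qed.

Lemma star_inj : injective star.
Proof.
suff H D D' : star D = star D' -> D `<=` D'.
  by move=> D D' e; apply/seteqP; split; apply: H.
by move=> e a /star_letter; rewrite e => /star_letter.
Qed.

Lemma star_mul_letter D a b : star D (mul [:: a] [:: b]) -> b = linv a.
Proof. by rewrite /mul /=; case: ifP => [/eqP //|_ [//|[c _]]]. Qed.

Section TwoLetters.
Variables (D : set (letter n)) (a0 b0 : letter n).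
Hypotheses (Da0 : D a0) (Db0 : D b0) (ab0 : a0 <> b0).

Lemma deg_one_star v : deg_one (star D) v <-> exists2 a, D a & v = [:: a].
Proof.
split=> [[[->|//] [c [_ cu]]]|[a Da ->]].
  have e1 : a0 = c by apply: cu; exact/star_letter.
  have e2 : b0 = c by apply: cu; exact/star_letter.
  by case: ab0; rewrite e1 e2.
split; first exact/star_letter.
exists (linv a); split; last by move=> b; exact: star_mul_letter.
by left; rewrite /mul /= eqxx.
Qed.

Lemma terminal_edge_star w a : terminal_edge (star D) w a <-> w = [::] /\ D a.
Proof.
split=> [[[->|[b Db ->]] /deg_one_star[c Dc]]|[-> Da]].
- by rewrite /mul /= => -[->].
- by rewrite /mul /=; case: ifP.
by split; [left|apply/deg_one_star; exists a].
Qed.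

Lemma star_subtree : is_subtree (star D).
Proof.
split.
  rewrite (_ : star D = [set [::]] `|` (fun a => [:: a]) @` D).
    by rewrite finite_setU; split=> //; apply: finite_image; exact: finite_finset.
  apply/seteqP; split=> v [->|[a Da]]; try by left.
    by move=> ->; right; exists a.
  by move=> <-; right; exists a.
split; first by move=> v [->|[a _ ->]].
split; first by exists [::]; left.
have T0 : `[< star D [::] >] by apply/asboolP; left.
have Ta a : D a -> `[< star D [:: a] >] by move=> Da; apply/asboolP/star_letter.
have up a : `[< @adjacent n [::] [:: a] >] by apply/asboolP; exists a.
have down a : `[< @adjacent n [:: a] [::] >].
  by apply/asboolP; exists (linv a); rewrite /mul /= eqxx.
move=> u v [->|[a Da ->]] [->|[b Db ->]].
- by exists [::].
- by exists [:: [:: b]]; split=> //=; rewrite ?up ?Ta.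
- by exists [:: [::]]; split=> //=; rewrite ?down ?T0.
- by exists [:: [::]; [:: b]]; split=> //=; rewrite ?down ?up ?T0 ?Ta.
Qed.

Lemma star_R1 : R1 (star D).
Proof.
split; [exact: star_subtree|by left| |by move=> v /deg_one_star[a _ ->]].
by exists a0, b0; split=> //; apply/star_letter.
Qed.

(** Every terminal edge of the star starts at the identity, so the cylinder conditions speak of
    first letters only. *)
Lemma SCyl_star S : SCyl (star D) S <-> first_letters S = D.
Proof.
split=> [[h1 h2]|e].
  apply/seteqP; split=> [_ [xi Sxi <-]|a Da].
    have [w [a [/terminal_edge_star[-> Da] e]]] := h1 _ Sxi.
    by have -> : xi 0%N = a by exact: e.
  have [|xi [Sxi <-]] := h2 [::] a; first exact/terminal_edge_star.
  by exists xi.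
split=> [xi Sxi|w a /terminal_edge_star[-> ]].
  exists [::], (xi 0%N); split=> //; apply/terminal_edge_star; split=> //.
  by rewrite -e; exists xi.
by rewrite -e => -[xi Sxi <-]; exists xi.
Qed.

End TwoLetters.

Definition pattern_letters (p : {set 1.-tuple (letter n)}) : set (letter n) :=
  [set a | [tuple a] \in p].

Lemma pattern_letters_inj : injective pattern_letters.
Proof.
move=> p q e; apply/setP => t.
have [a ->] : exists a, t = [tuple a].
  by case: t => [[|a [|]] // i]; exists a; exact: val_inj.
apply/idP/idP => h.
  by suff : pattern_letters q a by []; rewrite -e.
by suff : pattern_letters p a by []; rewrite e.
Qed.

Lemma pattern_letters_level S : pattern_letters (level_pattern 1 S) = first_letters S.
Proof.
apply/seteqP; split=> a; rewrite /pattern_letters /= inE.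
  by move=> /asboolP[xi Sxi /= [<-]]; exists xi.
by move=> [xi Sxi <-]; apply/asboolP; exists xi.
Qed.

End Star.

(** * Comparison of $\mu(K_1)$ with $V(\mu)$, and bounds for finite sums *)

Section Bounds.
Variables (R : realType) (n : nat).
Implicit Types (mu nu : {measure set (CN n) -> \bar R}).
Implicit Types (S : CN n) (T : set (word n)) (g : word n).
Local Notation K1 := (@hull_at_origin n).
Local Notation pattern k := {set k.-tuple (letter n)}.

Lemma hull_measure mu k : (0 < k)%N -> mu K1 = \sum_(p : pattern k) mu (cell p).
Proof.
move=> k0; rewrite (@measure_steps _ _ _ _ _ (fun=> 1%R) (@cell n k)) //.
- by apply: eq_bigr => p _; rewrite mul1e.
- exact: level_determined_measurable (@hull_at_origin_determined n 1 isT).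
- by move=> p; exact: level_determined_measurable (cell_determined k0).
- by move=> S; rewrite (sum_cells id (fun=> 1%R)) mul1r.
Qed.

Lemma sum_mass mu k : (0 < k)%N -> SCurr mu ->
  (\sum_(p : pattern k) mass mu p)%R%:E = mu K1.
Proof.
move=> k0 mS; rewrite (hull_measure mu k0) -sumEFin; apply: eq_bigr => p _.
by rewrite fineK // ge0_fin_numE // cell_finite.
Qed.

(** A member of the cell provides two different first letters, which puts the star in [R1]. *)
Lemma cell_star (p : pattern 1) : cell p !=set0 ->
  R1 (star (pattern_letters p)) /\ SCyl (star (pattern_letters p)) = cell p.
Proof.
move=> [S0 [K0 p0]].
have [xi [eta [Sxi Seta ne]]] := (Conv1P (@cset_reduced n S0)).1 K0.
have Dxi : pattern_letters p (xi 0%N) by rewrite -p0 pattern_letters_level; exists xi.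
have Deta : pattern_letters p (eta 0%N) by rewrite -p0 pattern_letters_level; exists eta.
split; first exact: star_R1 Dxi Deta ne.
apply/seteqP; split=> S.
  move=> /(SCyl_star Dxi Deta ne); rewrite -pattern_letters_level.
  move=> /pattern_letters_inj e; split=> //.
  move: e; rewrite -p0 => /level_patternP /esym e.
  exact: hull_at_origin_determined (esym e) K0.
move=> [KS pS]; apply/(SCyl_star Dxi Deta ne).
by rewrite -pattern_letters_level pS.
Qed.

(** The nonempty cells of level 1 are the cylinders of pairwise distinct stars, so $\mu(K_1)$ is a
    finite partial sum of $V(\mu)$. *)
Lemma hull_le_Vol mu : mu K1 <= Vol mu.
Proof.
pose good (p : pattern 1) := `[< cell p !=set0 >].
pose st (p : pattern 1) := star (pattern_letters p).
rewrite (hull_measure mu (isT : 0 < 1)%N) /Vol; apply: esum_ge.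
exists (st @` [set` good]).
  split; first by apply: finite_image; exact: finite_finset.
  by move=> _ [p /asboolP gp <-]; exact: (cell_star gp).1.
rewrite fsbig_image; last first.
  by move=> p q _ _ /star_inj /pattern_letters_inj.
rewrite -(@bigfs _ _ _ _ (index_enum _)) ?index_enum_uniq //; last first.
  by move=> p _; rewrite mem_index_enum.
rewrite (bigID good) /= [X in _ + X]big1 ?adde0; last first.
  by move=> p /asboolP /set0P /negP; rewrite negbK => /eqP ->; rewrite measure0.
by apply: lee_sum => p /asboolP /cell_star[_ ->].
Qed.

Definition rooted T := [/\ finite_set T, T `<=` @reduced n & T [::]].

Lemma rooted_bounded (s : seq (set (word n))) :
  (forall T, T \in s -> rooted T) ->
  exists L, forall T, T \in s -> forall t, T t -> (size t <= L)%N.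
Proof.
elim: s => [|T s IH] h; first by exists 0%N.
have [T' Ts|L hL] := IH; first by apply: h; rewrite in_cons Ts orbT.
have [fT _ _] := h T (mem_head _ _); have [M hM] := finite_words_bounded fT.
exists (maxn L M) => T'; rewrite in_cons => /orP[/eqP ->|Ts] t Tt.
  by rewrite leq_max hM ?orbT.
by rewrite leq_max (hL _ Ts).
Qed.

Lemma tact1 T : tact [::] T = T.
Proof. by apply/seteqP; split=> [_ [v Tv <-]|v Tv] //; exists v. Qed.

Lemma RR_measure1 mu nu T L : SCurr mu -> SCurr nu -> rooted T ->
  (forall t, T t -> (size t <= L)%N) ->
  (mu \x nu) (RR T) = ((\sum_p \sum_q (RR_patterns T p q)%:R *
     (@mass R n mu L.+2 p * @mass R n nu L.+2 q))%R)%:E.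
Proof.
by move=> mS nS [fT Tr T1] TL; rewrite -[in LHS](tact1 T) (RR_measure mS nS Tr T1 TL).
Qed.

Lemma RR_translate mu nu T g : SCurr mu -> SCurr nu -> rooted T -> reduced g ->
  (mu \x nu) (RR (tact g T)) = (mu \x nu) (RR T).
Proof.
move=> mS nS rT rg; have [fT Tr T1] := rT; have [L TL] := finite_words_bounded fT.
by rewrite (RR_measure1 mS nS rT TL) (RR_measure mS nS Tr T1 TL).
Qed.

(** A pair of patterns decides membership in every [RR T] of the list, and one pair of hulls has
    only one intersection, so at most one coefficient is 1. *)
Lemma RR_patterns_sum_le1 (s : seq (set (word n))) L (p q : pattern L.+2) :
  uniq s -> (forall T, T \in s -> T [::]) ->
  (forall T, T \in s -> forall t, T t -> (size t <= L)%N) ->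
  (\sum_(T <- s) (RR_patterns T p q)%:R <= 1 :> R)%R.
Proof.
move=> us s1 sL.
have [/hasP[T Ts /asboolP[S1 [S2 [rr e1 e2]]]]|/hasPn hN] :=
  boolP (has (fun T => RR_patterns T p q) s); last first.
  by rewrite big_seq big1 // => T /hN /negbTE ->.
rewrite (bigD1_seq T) //= big_seq_cond big1 ?addr0 ?lern1 ?leq_b1 //.
move=> T' /andP[T's /eqP nT]; case: (boolP (RR_patterns T' p q)) => // rr'.
case: nT; move: rr'; rewrite -e1 -e2 => /(RR_patternsP _ _ (s1 _ T's) (sL _ T's)).
by move: rr; rewrite /RR /= => -> .
Qed.

(** A common [L] writes all terms over the same cells; after exchanging sums each product of masses
    has coefficient at most 1. The trees may be translates of one another, which the tail estimate
    exploits. *)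
Lemma RR_sum_le mu nu (s : seq (set (word n))) : SCurr mu -> SCurr nu ->
  uniq s -> (forall T, T \in s -> rooted T) ->
  \sum_(T <- s) (mu \x nu) (RR T) <= mu K1 * nu K1.
Proof.
move=> mS nS us sr; have [L sL] := rooted_bounded sr.
have -> : \sum_(T <- s) (mu \x nu) (RR T) =
    ((\sum_(T <- s) \sum_p \sum_q (RR_patterns T p q)%:R *
     (@mass R n mu L.+2 p * @mass R n nu L.+2 q))%R)%:E.
  rewrite -sumEFin big_seq [RHS]big_seq; apply: eq_bigr => T Ts.
  by rewrite (RR_measure1 mS nS (sr _ Ts) (sL _ Ts)).
rewrite -(@sum_mass mu L.+2 isT mS) -(@sum_mass nu L.+2 isT nS) -EFinM lee_fin.
rewrite mulr_suml exchange_big /=; apply: ler_sum => p _.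
rewrite mulr_sumr exchange_big /=; apply: ler_sum => q _.
rewrite -mulr_suml ler_piMl ?mulr_ge0 ?mass_ge0 //.
by apply: RR_patterns_sum_le1 => // T /sr[].
Qed.

End Bounds.

(** * Classes of trees and the tail of the series *)

Section Classes.
Variables (n : nat).
Implicit Types (T : set (word n)) (g v : word n) (C : set (set (word n))).

Lemma Subbar1_rooted T : Subbar1 T -> rooted T.
Proof.
by case=> [[[fT [rT _]] [T1 _]]|->]; split=> // v ->.
Qed.

Lemma tclass_tact T T' g : Subbar1 T -> reduced g ->
  T' = tact g T -> tclass T' = tclass T.
Proof.
move=> sT rg ->; have [_ Tr _] := Subbar1_rooted sT.
apply/seteqP; split=> U [sU [h rh e]]; split=> //; rewrite e.
- by rewrite -tactM //; exists (mul h g) => //; exact: mul_reduced.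
- exists (mul h (winv g)); first by apply: mul_reduced; exact: winv_reduced.
  by rewrite tactM ?tactVK //; exact: tact_reduced.
Qed.

Lemma rep_in C : tclasses C -> C (rep C).
Proof.
move=> [T sT ->]; apply: (@xgetPex _ set0 (tclass T)); exists T.
by split=> //; exists [::]; rewrite ?tact1.
Qed.

Lemma rep_rooted C : tclasses C -> rooted (rep C).
Proof.
by move=> cC; have := rep_in cC; case: cC => T sT -> [/Subbar1_rooted].
Qed.

Lemma tclass_rep C : tclasses C -> tclass (rep C) = C.
Proof.
move=> cC; have := rep_in cC; case: (cC) => T sT CE; rewrite {1}CE => -[sr [g rg e]].
by rewrite (tclass_tact sT rg e) -CE.
Qed.

Lemma rep_translate_class C C' g g' : tclasses C -> tclasses C' ->
  reduced g -> reduced g' -> tact g (rep C) = tact g' (rep C') -> C = C'.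
Proof.
move=> cC cC' rg rg' e.
have [_ Tr _] := rep_rooted cC; have [_ Tr' _] := rep_rooted cC'.
rewrite -(tclass_rep cC) -(tclass_rep cC').
apply: esym; apply: (@tclass_tact _ _ (mul (winv g') g)).
- by have := rep_in cC; case: (cC) => T sT CE; rewrite {1}CE => -[].
- exact: mul_reduced.
- by rewrite tactM // e tactVK.
Qed.

(** Equal translates make $v'v^{-1}$ a stabilizer of [T], hence trivial. *)
Lemma translate_inj T v v' : rooted T -> reduced v -> reduced v' ->
  tact (winv v) T = tact (winv v') T -> v = v'.
Proof.
move=> [fT Tr T1] rv rv' e.
have h : mul v' (winv v) = [::].
  apply: (stabilizer_trivial fT _ Tr).
  - by exists [::].
  - by apply: mul_reduced; exact: winv_reduced.
  - by rewrite tactM // e tactKV.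
by rewrite -[v'](mulw1 rv') -(mulVK v (isT : reduced [::])) mulw1 // -mulA // h.
Qed.

(** A pair in [RR T] exhibits [T] as an intersection of two hulls through the identity, and each of
    them is closed under prefixes. *)
Lemma RR_prefix_closed T : rooted T -> RR T !=set0 ->
  forall i t, T t -> T (take i t).
Proof.
move=> [_ _ T1] [[S1 S2]]; rewrite /RR /= => e i t.
move: T1; rewrite -e => -[k1 k2] [c1 c2].
by split; apply: (@Conv_prefix _ _ _ (drop i t)); rewrite ?cat_take_drop //;
  exact: cset_reduced.
Qed.

Lemma small_classes_finite L :
  finite_set [set C : set (set (word n)) | tclasses C /\
    forall t, rep C t -> (size t <= L)%N].
Proof.
pose words (P : {set L.-bseq (letter n)}) : set (word n) :=
  [set v | exists2 t, t \in P & v = bseqval t].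
apply: (@sub_finite_set _ _ (@tclass n @` (words @` setT))); last first.
  by apply: finite_image; apply: finite_image; exact: finite_finset.
move=> C [cC hC]; exists (rep C); last exact: tclass_rep.
exists (finset (fun t : L.-bseq (letter n) => `[< rep C (bseqval t) >])) => //.
apply/seteqP; split=> [_ [t + ->]|v rv]; first by rewrite inE => /asboolP.
by exists (Bseq (hC _ rv)) => //; rewrite inE; apply/asboolP.
Qed.

End Classes.

(** * Bounds for partial sums over classes *)

Section Series.
Variables (R : realType) (n : nat).
Implicit Types (mu nu : {measure set (CN n) -> \bar R}).
Implicit Types (T : set (word n)) (C : set (set (word n))).
Local Notation K1 := (@hull_at_origin n).
Local Notation pattern k := {set k.-tuple (letter n)}.

Lemma product_measure1_nonneg mu nu (E : set (CN n * CN n)) : 0 <= (mu \x nu) E.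
Proof. by apply: integral_ge0. Qed.

Lemma product_measure1_set0 mu nu : (mu \x nu) set0 = 0.
Proof.
rewrite /product_measure1 (eq_integral (cst 0)) ?integral0 // => x _.
by rewrite /= xsection0 measure0.
Qed.

Lemma class_sum_le mu nu (X : seq (set (set (word n)))) : SCurr mu -> SCurr nu ->
  uniq X -> (forall C, C \in X -> tclasses C) ->
  \sum_(C <- X) (mu \x nu) (RR (rep C)) <= mu K1 * nu K1.
Proof.
move=> mS nS uX Xc.
rewrite -(big_map (@rep n) xpredT (fun T => (mu \x nu) (RR T))).
apply: RR_sum_le => //; last by move=> _ /mapP[C /Xc cC ->]; exact: rep_rooted.
rewrite map_inj_in_uniq // => C C' /Xc cC /Xc cC' e.
by rewrite -(tclass_rep cC) e tclass_rep.
Qed.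

(* A class whose tree reaches beyond distance [L] has at least [L.+1] distinct
   translates through the origin, all of the same measure. *)
Lemma tail_sum_le mu nu L (X : seq (set (set (word n)))) : SCurr mu -> SCurr nu ->
  uniq X -> (forall C, C \in X -> tclasses C) ->
  (forall C, C \in X -> exists t, rep C t /\ (L < size t)%N) ->
  \sum_(C <- X) (L.+1%:R%:E * (mu \x nu) (RR (rep C))) <= mu K1 * nu K1.
Proof.
move=> mS nS uX Xc XL.
(* Classes with empty [RR (rep C)] contribute zero; for the others [RR_prefix_closed] supplies the
   vertices to translate by. *)
pose ne C := `[< RR (rep C) !=set0 >].
rewrite (bigID ne) /= [X in _ + X]big1 ?adde0; last first.
  move=> C /asboolP /set0P /negP; rewrite negbK => /eqP ->.
  by rewrite product_measure1_set0 mule0.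
pose Y := [seq C <- X | ne C]; rewrite -big_filter -/Y.
have YX C : C \in Y -> C \in X /\ RR (rep C) !=set0.
  by rewrite mem_filter => /andP[/asboolP].
pose far C := xget [::] [set t | rep C t /\ (L < size t)%N].
have farP C : C \in Y -> rep C (far C) /\ (L < size (far C))%N.
  move=> /YX[CX _]; have [t ht] := XL _ CX.
  by apply: (@xgetPex _ [::] [set t | rep C t /\ (L < size t)%N]); exists t.
pose tr C i := tact (winv (take i (far C))) (rep C).
have repY C : C \in Y -> rooted (rep C) by move=> /YX[/Xc /rep_rooted].
have takeY C i : C \in Y -> rep C (take i (far C)).
  move=> CY; apply: RR_prefix_closed; [exact: repY|exact: (YX _ CY).2|].
  exact: (farP _ CY).1.
have takeR C i : C \in Y -> reduced (take i (far C)).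
  by move=> CY; have [_ Tr _] := repY _ CY; apply: Tr; exact: takeY.
have trE C i : C \in Y -> (mu \x nu) (RR (tr C i)) = (mu \x nu) (RR (rep C)).
  by move=> CY; apply: RR_translate => //; [exact: repY|apply: winv_reduced; exact: takeR].
have -> : \sum_(C <- Y) (L.+1%:R%:E * (mu \x nu) (RR (rep C))) =
    \sum_(T <- [seq tr C i | C <- Y, i <- iota 0 L.+1]) (mu \x nu) (RR T).
  rewrite big_allpairs_dep big_seq [RHS]big_seq; apply: eq_bigr => C CY.
  rewrite (eq_bigr (fun=> (mu \x nu) (RR (rep C)))); last by move=> i _; exact: trE.
  by rewrite big_const_seq count_predT size_iota iter_addr_0 mule_natl.
apply: RR_sum_le => //; last first.
  move=> _ /allpairsP[[C i] /= [CY _ ->]]; have [fT Tr T1] := repY _ CY; split.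
  - exact: finite_image.
  - exact: tact_reduced.
  - exists (take i (far C)); first exact: takeY.
    have rt := takeR C i CY.
    by rewrite -[X in mul _ X](mulw1 rt) mulVK.
apply: allpairs_uniq; rewrite ?iota_uniq ?filter_uniq //.
move=> x y /allpairsP[[C i] [CY iL ->]] /allpairsP[[C' i'] [CY' iL' ->]].
rewrite -[LHS]/(tr C i) -[RHS]/(tr C' i') => e.
move: iL iL'; rewrite !mem_iota !add0n ![_.2]/= => iL iL'.
rewrite ![_.1]/= in CY CY'.
have [rt rt'] := (takeR C i CY, takeR C' i' CY').
(* Coinciding translates have the same class, then the same vertex by freeness, hence the same
   distance from the identity. *)
have eC : C = C'.
  apply: rep_translate_class e; try exact: winv_reduced.
    by apply: Xc; exact: (YX _ CY).1.
  by apply: Xc; exact: (YX _ CY').1.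
move: e; rewrite /tr -eC in rt' *; move=> /(translate_inj (repY _ CY) rt rt') e.
have [_ Lt] := farP _ CY; move/(congr1 size): e.
have sz j : (j < L.+1)%N -> size (take j (far C)) = j.
  by move=> jL; apply: size_takel; lia.
by rewrite (sz _ iL) (sz _ iL') => ->; rewrite eC.
Qed.

End Series.

(** * Linearity and continuity *)

Section SeriesEstimates.
Variables (R : realType) (n : nat).
Implicit Types (mu nu : {measure set (CN n) -> \bar R}).
Implicit Types (T : set (word n)) (C : set (set (word n))).
Local Notation K1 := (@hull_at_origin n).
Local Notation pattern k := {set k.-tuple (letter n)}.

Lemma chat_le mu nu : SCurr mu -> SCurr nu -> chat mu nu <= mu K1 * nu K1.
Proof.
move=> mS nS; apply: ge_ereal_sup => _ [X [fX Xc] <-].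
rewrite fsbig_finite //; apply: class_sum_le => // [|C]; first exact: fset_uniq.
by rewrite in_fset_set // => /set_mem /Xc.
Qed.

Definition small_classes L : set (set (set (word n))) :=
  [set C | tclasses C /\ forall t, rep C t -> (size t <= L)%N].

Lemma tail_le mu nu L : SCurr mu -> SCurr nu ->
  \esum_(C in @tclasses n `&` ~` small_classes L) (mu \x nu) (RR (rep C)) <=
  (L.+1%:R^-1)%:E * (mu K1 * nu K1).
Proof.
move=> mS nS; apply: ge_ereal_sup => _ [X [fX Xc] <-].
rewrite fsbig_finite // lee_pdivlMl ?ltr0n // ge0_sume_distrr; last first.
  by move=> C _; exact: product_measure1_nonneg.
apply: tail_sum_le => // [|C|C]; first exact: fset_uniq.
  by rewrite in_fset_set // => /set_mem /Xc[].
rewrite in_fset_set // => /set_mem /Xc[cC].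
move=> /not_andP[//|/existsNP[t /not_implyP[rt /negP]]].
by rewrite -ltnNge; exists t.
Qed.

(** The coefficients [N] count small classes and are chosen before the currents: only the masses and
    the remainder depend on [mu] and [nu]. This order of quantifiers gives continuity. *)
Lemma chat_split L : exists N : pattern L.+2 -> pattern L.+2 -> R,
  (forall p q, (0 <= N p q)%R) /\
  forall mu nu, SCurr mu -> SCurr nu -> exists t : R,
    [/\ (0 <= t)%R,
        (t <= L.+1%:R^-1 * ((\sum_(p : pattern L.+2) mass mu p) *
               (\sum_(q : pattern L.+2) mass nu q)))%R &
        chat mu nu = (\sum_p \sum_q N p q * (mass mu p * mass nu q) + t)%R%:E].
Proof.
pose H := small_classes L.
have fH : finite_set H := @small_classes_finite n L.
exists (fun p q => \sum_(C <- fset_set H) (RR_patterns (rep C) p q)%:R)%R.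
split=> [p q|mu nu mS nS]; first by apply: sumr_ge0 => C _.
have t0 : 0 <= \esum_(C in @tclasses n `&` ~` H) (mu \x nu) (RR (rep C)).
  by apply: esum_ge0 => C _; exact: product_measure1_nonneg.
have tle := @tail_le mu nu L mS nS; rewrite -/H in tle.
rewrite -(@sum_mass R n mu L.+2 isT mS) -(@sum_mass R n nu L.+2 isT nS) -!EFinM in tle.
have [t tE] : exists t, \esum_(C in @tclasses n `&` ~` H) (mu \x nu) (RR (rep C)) = t%:E.
  exists (fine (\esum_(C in @tclasses n `&` ~` H) (mu \x nu) (RR (rep C)))).
  by rewrite fineK // ge0_fin_numE //; apply: le_lt_trans tle _; rewrite ltry.
exists t; rewrite tE !lee_fin in t0 tle; split=> //.
rewrite /chat (esumID H) ?tE; last by move=> C _; exact: product_measure1_nonneg.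
rewrite EFinD; congr (_ + _).
rewrite (_ : _ `&` H = H); last by apply/seteqP; split=> [C []|C [cC hC]].
rewrite esum_fset //; last by move=> C _; exact: product_measure1_nonneg.
rewrite fsbig_finite //.
transitivity (\sum_(C <- fset_set H) ((\sum_p \sum_q (RR_patterns (rep C) p q)%:R *
     (@mass R n mu L.+2 p * @mass R n nu L.+2 q))%R)%:E).
  rewrite big_seq [RHS]big_seq; apply: eq_bigr => C.
  rewrite in_fset_set // => /set_mem[cC hC].
  by rewrite (RR_measure1 mS nS (rep_rooted cC) hC).
rewrite sumEFin; congr (_%:E); rewrite exchange_big; apply: eq_bigr => p _.
by rewrite exchange_big; apply: eq_bigr => q _; rewrite mulr_suml.
Qed.

Lemma esumZl (I : choiceType) (A : set I) (f : I -> \bar R) (a : R) :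
  (0 <= a)%R -> (forall i, 0 <= f i) ->
  \esum_(i in A) (a%:E * f i) = a%:E * \esum_(i in A) f i.
Proof.
move=> a0 f0; rewrite /esum -ereal_supZl //; last first.
  by apply/set0P; exists (\sum_(x \in set0) f x); exists set0 => //; exact: fsets_set0.
congr ereal_sup; apply/seteqP; split=> [_ [X hX <-]|_ [_ [X hX <-] <-]].
  by exists (\sum_(x \in X) f x); [exists X|rewrite ge0_mule_fsumr].
by exists X => //; rewrite ge0_mule_fsumr.
Qed.

Lemma mass_linear (a b : R) mu1 mu2 mu3 k (p : pattern k) : (0 < k)%N ->
  SCurr mu1 -> SCurr mu2 ->
  (forall A : set (CN n), measurable A -> mu3 A = a%:E * mu1 A + b%:E * mu2 A) ->
  mass mu3 p = (a * mass mu1 p + b * mass mu2 p)%R.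
Proof.
move=> k0 m1 m2 h; rewrite /mass h; last first.
  exact: level_determined_measurable (cell_determined k0).
have f1 : mu1 (cell p) \is a fin_num by rewrite ge0_fin_numE // cell_finite.
have f2 : mu2 (cell p) \is a fin_num by rewrite ge0_fin_numE // cell_finite.
by rewrite -[in LHS](fineK f1) -[in LHS](fineK f2).
Qed.

(** Termwise: each term is a bilinear form in finite masses, and sums of nonnegative terms respect
    addition and scaling. *)
Lemma chat_bilinear (a b : R) mu1 mu2 mu3 nu : (0 <= a)%R -> (0 <= b)%R ->
  SCurr mu1 -> SCurr mu2 -> SCurr mu3 -> SCurr nu ->
  (forall A : set (CN n), measurable A -> mu3 A = a%:E * mu1 A + b%:E * mu2 A) ->
  chat mu3 nu = a%:E * chat mu1 nu + b%:E * chat mu2 nu /\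
  chat nu mu3 = a%:E * chat nu mu1 + b%:E * chat nu mu2.
Proof.
move=> a0 b0 m1 m2 m3 nS h.
have ge0 mu nu' C : 0 <= (mu \x nu') (RR (rep C)) by exact: product_measure1_nonneg.
have lin k p := @mass_linear a b mu1 mu2 mu3 k.+1 p isT m1 m2 h.
split; rewrite /chat -!esumZl // -esumD; try by move=> C _; rewrite mule_ge0.
all: apply: eq_esum => C cC; have rC := rep_rooted cC.
all: have [fT _ _] := rC; have [L TL] := finite_words_bounded fT.
all: rewrite !(RR_measure1 _ _ rC TL) // -!EFinM -EFinD; congr (_%:E).
all: rewrite !mulr_sumr -big_split /=; apply: eq_bigr => p _.
all: rewrite !mulr_sumr -big_split /=; apply: eq_bigr => q _.
all: by rewrite lin; ring.
Qed.

End SeriesEstimates.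

(** * Continuity for the weak-* topology *)

Section Continuity.
Variables (R : realType) (n : nat).
Implicit Types (mu nu : {measure set (CN n) -> \bar R}).
Local Notation K1 := (@hull_at_origin n).
Local Notation pattern k := {set k.-tuple (letter n)}.

(** The indicator is locally constant because the set is clopen; such indicators serve as test
    functions. *)
Lemma level_determined_indic_Cc k (A : set (CN n)) : level_determined k A ->
  A `<=` K1 -> Cc (\1_A : CN n -> R).
Proof.
move=> dA AK; split; last first.
  exists A; split; first exact: level_determined_compact dA AK.
  by move=> S nA; rewrite indicE memNset.
move=> S; apply: (@cvg_near_cst _ _ _ _ (nbhs (S : CN n)) (nbhs_filter (S : CN n))).
have [AS|nAS] := pselect (A S).
  have nA : nbhs S A by apply: open_nbhs_nbhs; split=> //; exact: level_determined_open dA.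
  by apply: filterS nA => S' AS'; rewrite !indicE !mem_set.
have nA : nbhs S (~` A).
  by apply: open_nbhs_nbhs; split=> //; exact: level_determined_open (level_determinedC dA).
by apply: filterS nA => S' AS'; rewrite !indicE !memNset.
Qed.

(** Termwise $|x'y' - xy| \le \delta(V + W + \delta)$, and $\delta \le 1$. *)
Lemma bilinear_perturbation (I : finType) (N : I -> I -> R) (x y x' y' : I -> R)
    (V W delta : R) :
  (forall p q, 0 <= N p q)%R -> (delta <= 1)%R ->
  (forall p, 0 <= x p <= V)%R -> (forall p, 0 <= y p <= W)%R ->
  (forall p, `|x' p - x p| <= delta)%R -> (forall p, `|y' p - y p| <= delta)%R ->
  (`| \sum_p \sum_q N p q * (x' p * y' q) - \sum_p \sum_q N p q * (x p * y q) | <=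
   delta * ((V + W + 1) * \sum_p \sum_q N p q))%R.
Proof.
move=> N0 d1 hx hy hx' hy'.
rewrite -sumrB mulrA mulr_sumr; apply: le_trans (ler_norm_sum _ _ _) _.
apply: ler_sum => p _; rewrite -sumrB mulr_sumr; apply: le_trans (ler_norm_sum _ _ _) _.
apply: ler_sum => q _; rewrite -mulrBr normrM ger0_norm // mulrC ler_wpM2r //.
have := hx p; have := hy q; have := hx' p; have := hy' q.
rewrite !ler_norml => /andP[a1 a2] /andP[b1 b2] /andP[c1 c2] /andP[d1' d2].
by apply/andP; split; nra.
Qed.

Lemma chat_continuous mu nu (eps : R) : SCurr mu -> SCurr nu -> (0 < eps)%R ->
  exists (m : nat) (fs : 'I_m -> CN n -> R) (delta : R),
    [/\ (0 < delta)%R, forall i, Cc (fs i) &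
     forall mu' nu' : {measure set (CN n) -> \bar R}, SCurr mu' -> SCurr nu' ->
       (forall i,
          `| \int[mu']_S (fs i S)%:E - \int[mu]_S (fs i S)%:E | < delta%:E /\
          `| \int[nu']_S (fs i S)%:E - \int[nu]_S (fs i S)%:E | < delta%:E) ->
       `| chat mu' nu' - chat mu nu | < eps%:E].
Proof.
move=> mS nS eps0.
pose V := fine (mu K1); pose W := fine (nu K1).
have V0 : (0 <= V)%R by exact: fine_ge0.
have W0 : (0 <= W)%R by exact: fine_ge0.
have VE k : (0 < k)%N -> (\sum_(p : pattern k) mass mu p)%R = V.
  by move=> k0; rewrite /V -(sum_mass k0 mS).
have WE k : (0 < k)%N -> (\sum_(p : pattern k) mass nu p)%R = W.
  by move=> k0; rewrite /W -(sum_mass k0 nS).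
(* The bounds $V+1$ and $W+1$ also hold for the total masses of nearby currents, so one [L] makes
   both tails less than [eps / 2]. *)
have [L hL] : exists L : nat, (L.+1%:R^-1 * ((V + 1) * (W + 1)) < eps / 2)%R.
  pose z := ((V + 1) * (W + 1) / (eps / 2))%R.
  exists (Num.bound z).
  have z0 : (0 <= z)%R by rewrite /z divr_ge0 // ?mulr_ge0 //; lra.
  have zb : (z < (Num.bound z).+1%:R)%R.
    by apply: lt_trans (archi_boundP z0) _; rewrite ltr_nat.
  rewrite mulrC ltr_pdivrMr ?ltr0n //.
  by move: zb; rewrite /z ltr_pdivrMr 1?mulrC //; lra.
have [N [N0 split_chat]] := @chat_split R n L.
pose Q := ((V + W + 1) * \sum_p \sum_q N p q)%R.
have Q0 : (0 <= Q)%R.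
  rewrite mulr_ge0 //; first by lra.
  by apply: sumr_ge0 => p _; apply: sumr_ge0.
pose m := #|pattern L.+2|.
(* The three summands give, for [delta] equal to $1/B$, the bounds $\delta \le 1$, $\delta m \le 1$
   and $\delta Q < \varepsilon/2$. *)
pose B := (1 + m%:R + 2 * (Q + 1) / eps)%R.
have q0 : (0 < 2 * (Q + 1) / eps)%R by rewrite divr_gt0 //; lra.
have m0 : (0 <= m%:R :> R)%R by rewrite ler0n.
have B0 : (0 < B)%R by rewrite /B; lra.
pose delta := (B^-1)%R.
have d0 : (0 < delta)%R by rewrite invr_gt0.
have dB : (delta * B = 1)%R by rewrite mulVf // gt_eqF.
have d1 : (delta <= 1)%R by rewrite /B in dB; nra.
have dm : (delta * m%:R <= 1)%R by rewrite /B in dB; nra.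
have dQ : (delta * Q < eps / 2)%R.
  have : (delta * (2 * (Q + 1) / eps) <= 1)%R by rewrite /B in dB; nra.
  rewrite mulrA ler_pdivrMr //; nra.
exists m, (fun i => \1_(cell (enum_val i))), delta; split=> //.
  by move=> i; apply: (@level_determined_indic_Cc L.+2); [exact: cell_determined|move=> S []].
move=> mu' nu' mS' nS' close.
have intE (mu0 : {measure set (CN n) -> \bar R}) (p : pattern L.+2) : SCurr mu0 ->
    \int[mu0]_S (\1_(cell p) S : R)%:E = (mass mu0 p)%:E.
  move=> m0S; rewrite integral_indic //; last first.
    exact: level_determined_measurable (cell_determined _).
  by rewrite setIT fineK // ge0_fin_numE // cell_finite.
have cx p : (`|@mass _ _ mu' L.+2 p - mass mu p| <= delta)%R.
  by have [+ _] := close (enum_rank p); rewrite enum_rankK !intE // -EFinB lte_fin => /ltW.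
have cy p : (`|@mass _ _ nu' L.+2 p - mass nu p| <= delta)%R.
  by have [_ +] := close (enum_rank p); rewrite enum_rankK !intE // -EFinB lte_fin => /ltW.
have sum_close (x x' : pattern L.+2 -> R) : (forall p, `|x' p - x p| <= delta)%R ->
    (\sum_p x' p <= \sum_p x p + 1)%R.
  move=> h; rewrite -lerBlDl -sumrB; apply: le_trans dm.
  rewrite mulr_natr -sumr_const; apply: ler_sum => p _.
  by apply: le_trans (h p); exact: ler_norm.
(* There are [m] cells, each with mass changed by at most [delta], so the total mass grows by at
   most 1. *)
have V'le := sum_close _ _ cx; have W'le := sum_close _ _ cy.
rewrite VE // in V'le; rewrite WE // in W'le.
have [t [t0 tle ->]] := split_chat mu nu mS nS.
have [t' [t0' tle' ->]] := split_chat mu' nu' mS' nS'.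
rewrite VE // WE // in tle.
rewrite -EFinB abse_EFin lte_fin.
have mle (mu0 : {measure set (CN n) -> \bar R}) k (p : pattern k) :
    (0 <= mass mu0 p <= \sum_(q : pattern k) mass mu0 q)%R.
  rewrite mass_ge0 (bigD1 p) //= lerDl; apply: sumr_ge0 => q _; exact: mass_ge0.
have hx p : (0 <= @mass _ _ mu L.+2 p <= V)%R by rewrite -(VE L.+2).
have hy p : (0 <= @mass _ _ nu L.+2 p <= W)%R by rewrite -(WE L.+2).
have := bilinear_perturbation N0 d1 hx hy cx cy; rewrite -/Q.
set h' := (\sum_p \sum_q _ * (mass mu' _ * _))%R.
set h := (\sum_p \sum_q _ * (mass mu _ * _))%R.
have L0 : (0 <= L.+1%:R^-1 :> R)%R by rewrite invr_ge0 ler0n.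
have T : (t < eps / 2)%R.
  apply: le_lt_trans tle _; apply: le_lt_trans hL; rewrite ler_wpM2l // ler_pM //; lra.
have T' : (t' < eps / 2)%R.
  apply: le_lt_trans tle' _; apply: le_lt_trans hL; rewrite ler_wpM2l // ler_pM //.
    by apply: sumr_ge0 => p _; exact: mass_ge0.
  by apply: sumr_ge0 => p _; exact: mass_ge0.
(* Both tails lie in $[0, \varepsilon/2)$, so their difference is below $\varepsilon/2$ in absolute
   value, as is that of the finite parts. *)
rewrite ler_norml ltr_norml => /andP[e1 e2]; apply/andP; split; lra.
Qed.

End Continuity.

Theorem mainTheorem7 (R : realType) (n : nat) :
  (* convergence of the series, with value at most V(mu) V(nu) *)
  (forall mu nu : {measure set (CN n) -> \bar R}, SCurr mu -> SCurr nu ->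
     chat mu nu < +oo /\ chat mu nu <= Vol mu * Vol nu)
  /\
  (* R_{>=0}-bilinearity *)
  (forall (a b : R) (mu1 mu2 mu3 nu : {measure set (CN n) -> \bar R}),
     (0 <= a)%R -> (0 <= b)%R ->
     SCurr mu1 -> SCurr mu2 -> SCurr mu3 -> SCurr nu ->
     (forall A : set (CN n), measurable A ->
        mu3 A = a%:E * mu1 A + b%:E * mu2 A) ->
     chat mu3 nu = a%:E * chat mu1 nu + b%:E * chat mu2 nu /\
     chat nu mu3 = a%:E * chat nu mu1 + b%:E * chat nu mu2)
  /\
  (* continuity for the (product of the) weak-* topologies *)
  (forall mu nu : {measure set (CN n) -> \bar R}, SCurr mu -> SCurr nu ->
   forall eps : R, (0 < eps)%R ->
   exists (m : nat) (fs : 'I_m -> CN n -> R) (delta : R),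
     [/\ (0 < delta)%R, forall i, Cc (fs i) &
      forall mu' nu' : {measure set (CN n) -> \bar R}, SCurr mu' -> SCurr nu' ->
        (forall i,
           `| \int[mu']_S (fs i S)%:E - \int[mu]_S (fs i S)%:E | < delta%:E /\
           `| \int[nu']_S (fs i S)%:E - \int[nu]_S (fs i S)%:E | < delta%:E) ->
        `| chat mu' nu' - chat mu nu | < eps%:E]).
Proof.
split; [|split].
- move=> mu nu mS nS; have le := chat_le mS nS.
  split; last by apply: le_trans le _; apply: lee_pmul => //; exact: hull_le_Vol.
  apply: le_lt_trans le _.
  rewrite lte_mul_pinfty // ?hull_at_origin_finite //.
  by rewrite ge0_fin_numE ?hull_at_origin_finite.
- by move=> a b mu1 mu2 mu3 nu; exact: chat_bilinear.
- by move=> mu nu mS nS eps; exact: chat_continuous.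
Qed.
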